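(* Let $F:\mathcal C\to\mathcal D$ be a tensor functor. Then the cosimplicial monoid $E(F)$, $E(F)(n)=End(F^{\otimes n})$, is $1$-commutative.
   Context: Tensor categories are $k$-linear monoidal categories ($k$ a field) with unit $I$, tensor functors are $k$-linear strong monoidal functors. **The cosimplicial monoid $E(F)$.** $F^{\otimes n}:\mathcal C^{\times n}\to\mathcal D$, $F^{\otimes n}(X_1,\dots,X_n)=F(X_1\otimes(X_2\otimes(\cdots(X_{n-1}\otimes X_n)\cdots)))$, and $F^{\otimes0}:\mathrm{Vect}_k\to\mathcal D$, $V\mapsto V\otimes I$. $E(F)(n)=End(F^{\otimes n})$ is the monoid (algebra) of natural endomorphisms under composition; $E(F)(0)=End_{\mathcal D}(I)$. Coface maps $\partial_i:End(F^{\otimes n})\to End(F^{\otimes n+1})$, $0\le i\le n+1$: $\partial_0(a)_{X_1,\dots,X_{n+1}}$ is $1_{F(X_1)}\otimes a_{X_2,\dots,X_{n+1}}$ conjugated by the tensor constraint $F(X_1)\otimes F(X_2\otimes\cdots)\to F(X_1\otimes(X_2\otimes\cdots))$; for $1\le i\le n$, $\partial_i(a)_{X_1,\dots,X_{n+1}}$ is $a_{X_1,\dots,X_i\otimes X_{i+1},\dots,X_{n+1}}$ conjugated by $F$ of the associativity isomorphism; $\partial_{n+1}(a)_{X_1,\dots,X_{n+1}}$ is $a_{X_1,\dots,X_n}\otimes1_{F(X_{n+1})}$ conjugated by the coherence isomorphism $F(X_1\otimes\cdots\otimes X_n)\otimes F(X_{n+1})\to F(X_1\otimes\cdots\otimes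 X_{n+1})$. For $n=0$, $\partial_0(a)_X$ and $\partial_1(a)_X$ are $1_{F(X)}\otimes a$ and $a\otimes1_{F(X)}$ transported along the unit isomorphisms. Codegeneracies $\sigma_i:End(F^{\otimes n})\to End(F^{\otimes n-1})$, $0\le i\le n-1$: $\sigma_i(a)_{X_1,\dots,X_{n-1}}=a_{X_1,\dots,X_i,I,X_{i+1},\dots,X_{n-1}}$. **$1$-commutativity.** For nondecreasing $\tau:[p]\to[m]$, $\pi:[q]\to[m]$ (with $[m]=\{0<\dots<m\}$), a shuffling of length $n$ is a pair of decompositions into nonempty disjoint sets $Im(\tau)=A_1\cup\dots\cup A_s$, $A_1<\dots<A_s$, $Im(\pi)=B_1\cup\dots\cup B_t$, $B_1<\dots<B_t$, $s+t=n+1$, $|s-t|\le1$, with $A_1\le B_1\le A_2\le B_2\le\cdots$ or $B_1\le A_1\le B_2\le A_2\le\cdots$, where $A\le B$ means each element of $A$ is $\le$ each element of $B$. The linking number is the least length of a shuffling. A cosimplicial monoid $E$ is $n$-commutative ($n\ge1$) if for all $\tau,\pi$ with the same target $[m]$ and linking number $\le n$ the images of $E(\tau)$ and $E(\pi)$ commute in $E(m)$. *)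

(* Defs.v *)
From HB Require Import structures.
From mathcomp Require Import all_boot all_order ssralg.
From mathcomp Require Import boolp.

Set Implicit Arguments.
Unset Strict Implicit.
Unset Printing Implicit Defensive.

Declare Scope cat_scope.
Delimit Scope cat_scope with C.
Local Open Scope cat_scope.

(** * k-linear categories and tensor categories *)

Record lin_category (k : fieldType) := LinCategory {
  ob :> Type;
  hom : ob -> ob -> lmodType k;
  idm : forall X, hom X X;
  comp : forall X Y Z, hom Y Z -> hom X Y -> hom X Z;
  comp_idl : forall X Y (f : hom X Y), comp (idm Y) f = f;
  comp_idr : forall X Y (f : hom X Y), comp f (idm X) = f;
  comp_assoc : forall X Y Z W (h : hom Z W) (g : hom Y Z) (f : hom X Y),
    comp h (comp g f) = comp (comp h g) f;
  comp_linl : forall X Y Z (f : hom X Y), linear (fun g : hom Y Z => comp g f);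
  comp_linr : forall X Y Z (g : hom Y Z), linear (fun f : hom X Y => comp g f)
}.

Arguments idm {k l} X : rename.
Arguments comp {k l X Y Z} g f : rename.
Notation "g \co f" := (comp g f) (at level 40, left associativity) : cat_scope.

Record iso (k : fieldType) (C : lin_category k) (X Y : C) := Iso {
  fwd :> hom X Y;
  bwd : hom Y X;
  fwdK : bwd \co fwd = idm X;
  bwdK : fwd \co bwd = idm Y
}.

Record tensor_category (k : fieldType) := TensorCategory {
  tcat :> lin_category k;
  unit_ob : tcat;
  tensor : tcat -> tcat -> tcat;
  tensorh : forall X X' Y Y' : tcat,
    hom X X' -> hom Y Y' -> hom (tensor X Y) (tensor X' Y');
  assoc : forall X Y Z : tcat,
    iso (tensor (tensor X Y) Z) (tensor X (tensor Y Z));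
  lunit : forall X : tcat, iso (tensor unit_ob X) X;
  runit : forall X : tcat, iso (tensor X unit_ob) X;
  tensorh_id : forall X Y : tcat, tensorh (idm X) (idm Y) = idm (tensor X Y);
  tensorh_comp : forall (X X' X'' Y Y' Y'' : tcat)
    (f' : hom X' X'') (f : hom X X') (g' : hom Y' Y'') (g : hom Y Y'),
    tensorh (f' \co f) (g' \co g) = tensorh f' g' \co tensorh f g;
  tensorh_linl : forall (X X' Y Y' : tcat) (g : hom Y Y'),
    linear (fun f : hom X X' => tensorh f g);
  tensorh_linr : forall (X X' Y Y' : tcat) (f : hom X X'),
    linear (fun g : hom Y Y' => tensorh f g);
  assoc_nat : forall (X X' Y Y' Z Z' : tcat)
    (f : hom X X') (g : hom Y Y') (h : hom Z Z'),
    assoc X' Y' Z' \co tensorh (tensorh f g) h =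
    tensorh f (tensorh g h) \co assoc X Y Z;
  lunit_nat : forall (X X' : tcat) (f : hom X X'),
    lunit X' \co tensorh (idm unit_ob) f = f \co lunit X;
  runit_nat : forall (X X' : tcat) (f : hom X X'),
    runit X' \co tensorh f (idm unit_ob) = f \co runit X;
  pentagon : forall X Y Z W : tcat,
    assoc X Y (tensor Z W) \co assoc (tensor X Y) Z W =
    tensorh (idm X) (assoc Y Z W) \co assoc X (tensor Y Z) W
      \co tensorh (assoc X Y Z) (idm W);
  triangle : forall X Y : tcat,
    tensorh (idm X) (lunit Y) \co assoc X unit_ob Y =
    tensorh (runit X) (idm Y)
}.

Arguments unit_ob {k} t.
Arguments assoc {k t} X Y Z.
Arguments lunit {k t} X.
Arguments runit {k t} X.
Notation "X \ox Y" := (tensor X Y) (at level 35, right associativity) : cat_scope.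
Notation "f \oh g" := (tensorh f g) (at level 35, right associativity) : cat_scope.

Record tensor_functor (k : fieldType) (C D : tensor_category k) := TensorFunctor {
  fob :> C -> D;
  fhom : forall X Y : C, hom X Y -> hom (fob X) (fob Y);
  fhom_id : forall X : C, fhom (idm X) = idm (fob X);
  fhom_comp : forall (X Y Z : C) (g : hom Y Z) (f : hom X Y),
    fhom (g \co f) = fhom g \co fhom f;
  fhom_lin : forall X Y : C, linear (@fhom X Y);
  fmul : forall X Y : C, iso (fob X \ox fob Y) (fob (X \ox Y));
  fone : iso (unit_ob D) (fob (unit_ob C));
  fmul_nat : forall (X X' Y Y' : C) (f : hom X X') (g : hom Y Y'),
    fmul X' Y' \co (fhom f \oh fhom g) = fhom (f \oh g) \co fmul X Y;
  fmul_assoc : forall X Y Z : C,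
    fhom (assoc X Y Z) \co fmul (X \ox Y) Z \co (fmul X Y \oh idm (fob Z)) =
    fmul X (Y \ox Z) \co (idm (fob X) \oh fmul Y Z)
      \co assoc (fob X) (fob Y) (fob Z);
  fmul_lunit : forall X : C,
    fhom (lunit X) \co fmul (unit_ob C) X \co (fone \oh idm (fob X)) =
    lunit (fob X);
  fmul_runit : forall X : C,
    fhom (runit X) \co fmul X (unit_ob C) \co (idm (fob X) \oh fone) =
    runit (fob X)
}.

Arguments fhom {k C D} F {X Y} f : rename.
Arguments fmul {k C D} F X Y : rename.
Arguments fone {k C D} F : rename.

(** * Isomorphisms *)

Section Isos.
Variables (k : fieldType) (C : lin_category k).

Definition iso_id (X : C) : iso X X := Iso (comp_idl (idm X)) (comp_idl (idm X)).

Definition iso_inv (X Y : C) (u : iso X Y) : iso Y X := Iso (bwdK u) (fwdK u).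

Lemma iso_comp_subproof (X Y Z : C) (v : iso Y Z) (u : iso X Y) :
  (bwd u \co bwd v) \co (v \co u) = idm X.
Proof. by rewrite comp_assoc -(comp_assoc (bwd u)) fwdK comp_idr fwdK. Qed.

Definition iso_comp (X Y Z : C) (v : iso Y Z) (u : iso X Y) : iso X Z :=
  @Iso _ _ _ _ (v \co u) (bwd u \co bwd v)
    (iso_comp_subproof v u) (iso_comp_subproof (iso_inv u) (iso_inv v)).

(* Transport of an endomorphism along an isomorphism. *)
Definition conj_iso (X Y : C) (u : iso X Y) (a : hom X X) : hom Y Y :=
  u \co a \co bwd u.

Lemma iso_bwd_nat (X Y X' Y' : C) (u : iso X Y) (v : iso X' Y')
  (f : hom X X') (g : hom Y Y') :
  v \co f = g \co u -> bwd v \co g = f \co bwd u.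
Proof.
move=> e; rewrite -[g]comp_idr -(bwdK u) (comp_assoc g) -e.
by rewrite !comp_assoc fwdK comp_idl.
Qed.

Lemma conj_iso_nat (X Y X' Y' : C) (u : iso X Y) (v : iso X' Y')
  (f : hom X X') (g : hom Y Y') (a : hom X X) (b : hom X' X') :
  v \co f = g \co u -> b \co f = f \co a ->
  conj_iso v b \co g = g \co conj_iso u a.
Proof.
move=> e eab; rewrite /conj_iso -comp_assoc (iso_bwd_nat e).
by rewrite comp_assoc -(comp_assoc (fwd v)) eab !comp_assoc e.
Qed.

End Isos.

Lemma iso_tensor_subproof (k : fieldType) (C : tensor_category k)
  (X X' Y Y' : C) (u : iso X X') (v : iso Y Y') :
  (bwd u \oh bwd v) \co (u \oh v) = idm (X \ox Y).
Proof. by rewrite -tensorh_comp !fwdK tensorh_id. Qed.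

Definition iso_tensor (k : fieldType) (C : tensor_category k) (X X' Y Y' : C)
    (u : iso X X') (v : iso Y Y') : iso (X \ox Y) (X' \ox Y') :=
  Iso (iso_tensor_subproof u v) (iso_tensor_subproof (iso_inv u) (iso_inv v)).

Lemma iso_fun_subproof (k : fieldType) (C D : tensor_category k)
  (F : tensor_functor C D) (X Y : C) (u : iso X Y) :
  fhom F (bwd u) \co fhom F u = idm (F X).
Proof. by rewrite -fhom_comp fwdK fhom_id. Qed.

Definition iso_fun (k : fieldType) (C D : tensor_category k)
    (F : tensor_functor C D) (X Y : C) (u : iso X Y) : iso (F X) (F Y) :=
  Iso (iso_fun_subproof F u) (iso_fun_subproof F (iso_inv u)).

(** * Powers of a category and iterated tensor products *)

(* n-tuples are right-nested pairs (x_1, (x_2, ... (x_n, tt))). *)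
Fixpoint pow (T : Type) (n : nat) : Type :=
  if n is m.+1 then (T * pow T m)%type else unit.

Fixpoint pow_init (T : Type) n : pow T n.+1 -> pow T n :=
  match n with
  | 0 => fun _ => tt
  | m.+1 => fun X => (X.1, @pow_init T m X.2)
  end.

Fixpoint pow_last (T : Type) n : pow T n.+1 -> T :=
  match n with
  | 0 => fun X => X.1
  | m.+1 => fun X => @pow_last T m X.2
  end.

Section Powers.
Variables (k : fieldType) (C : tensor_category k).

Fixpoint hom_pow n : pow C n -> pow C n -> Type :=
  match n with
  | 0 => fun _ _ => unit
  | m.+1 => fun X Y => (hom X.1 Y.1 * hom_pow X.2 Y.2)%type
  end.

(* X_1 \ox (X_2 \ox (... \ox X_{n+1})), with no trailing unit object. *)
Fixpoint tens n : pow C n.+1 -> C :=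
  match n with
  | 0 => fun X => X.1
  | m.+1 => fun X => X.1 \ox @tens m X.2
  end.

Fixpoint tens_hom n : forall X Y : pow C n.+1,
    hom_pow X Y -> hom (tens X) (tens Y) :=
  match n with
  | 0 => fun X Y f => f.1
  | m.+1 => fun X Y f => f.1 \oh @tens_hom m X.2 Y.2 f.2
  end.

Fixpoint tens_last n : forall X : pow C n.+2,
    iso (tens (pow_init X) \ox pow_last X) (tens X) :=
  match n return forall X : pow C n.+2,
    iso (tens (pow_init X) \ox pow_last X) (tens X) with
  | 0 => fun X => iso_id (X.1 \ox X.2.1)
  | m.+1 => fun X =>
      iso_comp (iso_tensor (iso_id X.1) (@tens_last m X.2))
        (assoc X.1 (@tens m (@pow_init C m.+1 X.2)) (@pow_last C m.+1 X.2))
  end.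

(* (X_1, ..., X_{j+1} \ox X_{j+2}, ..., X_{n+2}); only used for j <= n. *)
Fixpoint pow_merge n (j : nat) : pow C n.+2 -> pow C n.+1 :=
  match n, j with
  | m.+1, i.+1 => fun X => (X.1, @pow_merge m i X.2)
  | _, _ => fun X => (X.1 \ox X.2.1, X.2.2)
  end.

Fixpoint tens_merge n (j : nat) : forall X : pow C n.+2,
    iso (tens (pow_merge j X)) (tens X) :=
  match n, j return forall X : pow C n.+2,
    iso (tens (pow_merge j X)) (tens X) with
  | 0, _ => fun X => iso_id (X.1 \ox X.2.1)
  | m.+1, 0 => fun X => assoc X.1 X.2.1 (@tens m X.2.2)
  | m.+1, i.+1 => fun X => iso_tensor (iso_id X.1) (@tens_merge m i X.2)
  end.

(* (X_1, ..., X_j, I, X_{j+1}, ..., X_n); only used for j <= n. *)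
Fixpoint pow_insert n (j : nat) : pow C n -> pow C n.+1 :=
  match n, j with
  | m.+1, i.+1 => fun X => (X.1, @pow_insert m i X.2)
  | _, _ => fun X => (unit_ob C, X)
  end.

Fixpoint tens_insert n (j : nat) : forall X : pow C n.+1,
    iso (tens (pow_insert j X)) (tens X) :=
  match n, j return forall X : pow C n.+1,
    iso (tens (pow_insert j X)) (tens X) with
  | n', 0 => fun X => lunit (tens X)
  | 0, _.+1 => fun X => runit X.1
  | m.+1, i.+1 => fun X => iso_tensor (iso_id X.1) (@tens_insert m i X.2)
  end.

Fixpoint hom_init n : forall X Y : pow C n.+1,
    hom_pow X Y -> hom_pow (pow_init X) (pow_init Y) :=
  match n return forall X Y : pow C n.+1,
    hom_pow X Y -> hom_pow (pow_init X) (pow_init Y) with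
  | 0 => fun X Y f => tt
  | m.+1 => fun X Y f => (f.1, @hom_init m X.2 Y.2 f.2)
  end.

Fixpoint hom_last n : forall X Y : pow C n.+1,
    hom_pow X Y -> hom (pow_last X) (pow_last Y) :=
  match n return forall X Y : pow C n.+1,
    hom_pow X Y -> hom (pow_last X) (pow_last Y) with
  | 0 => fun X Y f => f.1
  | m.+1 => fun X Y f => @hom_last m X.2 Y.2 f.2
  end.

Fixpoint hom_merge n (j : nat) : forall X Y : pow C n.+2,
    hom_pow X Y -> hom_pow (pow_merge j X) (pow_merge j Y) :=
  match n, j return forall X Y : pow C n.+2,
    hom_pow X Y -> hom_pow (pow_merge j X) (pow_merge j Y) with
  | 0, _ => fun X Y f => (f.1 \oh f.2.1, f.2.2)
  | m.+1, 0 => fun X Y f => (f.1 \oh f.2.1, f.2.2)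
  | m.+1, i.+1 => fun X Y f => (f.1, @hom_merge m i X.2 Y.2 f.2)
  end.

Fixpoint hom_insert n (j : nat) : forall X Y : pow C n,
    hom_pow X Y -> hom_pow (pow_insert j X) (pow_insert j Y) :=
  match n, j return forall X Y : pow C n,
    hom_pow X Y -> hom_pow (pow_insert j X) (pow_insert j Y) with
  | 0, _ => fun X Y f => (idm (unit_ob C), f)
  | m.+1, 0 => fun X Y f => (idm (unit_ob C), f)
  | m.+1, i.+1 => fun X Y f => (f.1, @hom_insert m i X.2 Y.2 f.2)
  end.

Lemma tens_last_nat n (X Y : pow C n.+2) (f : hom_pow X Y) :
  tens_last Y \co (tens_hom (hom_init f) \oh hom_last f) =
  tens_hom f \co tens_last X.
Proof.
elim: n X Y f => [|n IH] X Y f /=; first by rewrite comp_idl comp_idr.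
rewrite -comp_assoc assoc_nat !comp_assoc -!tensorh_comp.
by rewrite (IH X.2 Y.2 f.2) comp_idl comp_idr.
Qed.

Lemma tens_merge_nat n j (X Y : pow C n.+2) (f : hom_pow X Y) :
  tens_merge j Y \co tens_hom (hom_merge j f) = tens_hom f \co tens_merge j X.
Proof.
elim: n j X Y f => [|n IH] [|j] X Y f /=; rewrite ?comp_idl ?comp_idr //.
  exact: assoc_nat.
by rewrite -!tensorh_comp (IH j X.2 Y.2 f.2) comp_idl comp_idr.
Qed.

Lemma tens_insert_nat n j (X Y : pow C n.+1) (f : hom_pow X Y) :
  tens_insert j Y \co tens_hom (hom_insert j f) =
  tens_hom f \co tens_insert j X.
Proof.
elim: n j X Y f => [|n IH] [|j] X Y f /=; try exact: lunit_nat.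
  exact: runit_nat.
by rewrite -!tensorh_comp (IH j X.2 Y.2 f.2) comp_idl comp_idr.
Qed.

End Powers.

(** * Natural endomorphisms of the powers of a tensor functor *)

Section NatEnd.
Variables (k : fieldType) (C D : tensor_category k) (F : tensor_functor C D).

(* For n = 0 this is the constant functor with value I on the one-object
   category C^0. Its endomorphisms are the endomorphisms of I, as are those of
   the functor V |-> V \ox I on vector spaces. *)
Definition fpow n : pow C n -> D :=
  match n with
  | 0 => fun _ => unit_ob D
  | m.+1 => fun X => F (@tens k C m X)
  end.

Definition fpow_hom n : forall X Y : pow C n,
    hom_pow X Y -> hom (fpow X) (fpow Y) :=
  match n return forall X Y : pow C n, hom_pow X Y -> hom (fpow X) (fpow Y) with
  | 0 => fun _ _ _ => idm (unit_ob D)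
  | m.+1 => fun X Y f => fhom F (@tens_hom k C m X Y f)
  end.

Record nat_end (n : nat) := NatEnd {
  nat_app :> forall X : pow C n, hom (fpow X) (fpow X);
  nat_nat : forall (X Y : pow C n) (f : hom_pow X Y),
    nat_app Y \co fpow_hom f = fpow_hom f \co nat_app X
}.

Lemma nat_endP n (a b : nat_end n) : (forall X, a X = b X) -> a = b.
Proof.
case: a b => [a na] [b nb] /= ab.
have eab : a = b by apply: functional_extensionality_dep.
by subst b; congr NatEnd; apply: Prop_irrelevance.
Qed.

Lemma nat_one_nat n (X Y : pow C n) (f : hom_pow X Y) :
  idm (fpow Y) \co fpow_hom f = fpow_hom f \co idm (fpow X).
Proof. by rewrite comp_idl comp_idr. Qed.

Definition nat_one n : nat_end n := NatEnd (@nat_one_nat n).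

Lemma nat_mul_nat n (a b : nat_end n) (X Y : pow C n) (f : hom_pow X Y) :
  (a Y \co b Y) \co fpow_hom f = fpow_hom f \co (a X \co b X).
Proof. by rewrite -comp_assoc nat_nat !comp_assoc nat_nat. Qed.

Definition nat_mul n (a b : nat_end n) : nat_end n := NatEnd (nat_mul_nat a b).

Lemma nat_mulA n : associative (@nat_mul n).
Proof. by move=> a b c; apply: nat_endP => X /=; rewrite comp_assoc. Qed.

Lemma nat_mul1 n : left_id (nat_one n) (@nat_mul n).
Proof. by move=> a; apply: nat_endP => X /=; rewrite comp_idl. Qed.

Lemma nat_1mul n : right_id (nat_one n) (@nat_mul n).
Proof. by move=> a; apply: nat_endP => X /=; rewrite comp_idr. Qed.

HB.instance Definition _ n := gen_eqMixin (nat_end n).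
HB.instance Definition _ n := gen_choiceMixin (nat_end n).
HB.instance Definition _ n :=
  isMonoid.Build (nat_end n) (@nat_mulA n) (@nat_mul1 n) (@nat_1mul n).

(** ** Coface maps *)

Definition coface_first_app n : nat_end n ->
    forall X : pow C n.+1, hom (fpow X) (fpow X) :=
  match n return nat_end n ->
    forall X : pow C n.+1, hom (fpow X) (fpow X) with
  | 0 => fun a X => conj_iso (runit (F X.1)) (idm (F X.1) \oh a tt)
  | m.+1 => fun a X =>
      conj_iso (fmul F X.1 (@tens k C m X.2)) (idm (F X.1) \oh a X.2)
  end.

Lemma coface_first_nat n (a : nat_end n) (X Y : pow C n.+1)
    (f : hom_pow X Y) :
  coface_first_app a Y \co fpow_hom f = fpow_hom f \co coface_first_app a X.
Proof.
case: n a X Y f => [|n] a X Y f.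
  apply: conj_iso_nat (runit_nat _) _.
  by rewrite -!tensorh_comp !comp_idl !comp_idr.
apply: conj_iso_nat (fmul_nat F f.1 (@tens_hom k C n X.2 Y.2 f.2)) _.
rewrite -!tensorh_comp comp_idl comp_idr; congr (_ \oh _).
exact: (@nat_nat _ a X.2 Y.2 f.2).
Qed.

Definition coface_last_app n : nat_end n ->
    forall X : pow C n.+1, hom (fpow X) (fpow X) :=
  match n return nat_end n ->
    forall X : pow C n.+1, hom (fpow X) (fpow X) with
  | 0 => fun a X => conj_iso (lunit (F X.1)) (a tt \oh idm (F X.1))
  | m.+1 => fun a X =>
      conj_iso (iso_comp (iso_fun F (tens_last X))
                  (fmul F (@tens k C m (pow_init X)) (pow_last X)))
        (a (pow_init X) \oh idm (F (pow_last X)))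
  end.

Lemma coface_last_nat n (a : nat_end n) (X Y : pow C n.+1)
    (f : hom_pow X Y) :
  coface_last_app a Y \co fpow_hom f = fpow_hom f \co coface_last_app a X.
Proof.
case: n a X Y f => [|n] a X Y f.
  apply: conj_iso_nat (lunit_nat _) _.
  by rewrite -!tensorh_comp !comp_idl !comp_idr.
apply: (conj_iso_nat
  (f := fhom F (tens_hom (hom_init f)) \oh fhom F (hom_last f))).
  rewrite /= -comp_assoc fmul_nat !comp_assoc -!fhom_comp.
  by rewrite (tens_last_nat f).
rewrite -!tensorh_comp comp_idl comp_idr; congr (_ \oh _).
exact: (nat_nat a (hom_init f)).
Qed.

(* Merges X_{j+1} and X_{j+2}; only used for j <= n. *)
Definition coface_inner_app n (j : nat) (a : nat_end n.+1) (X : pow C n.+2) :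
    hom (fpow X) (fpow X) :=
  conj_iso (iso_fun F (tens_merge j X)) (a (pow_merge j X)).

Lemma coface_inner_nat n j (a : nat_end n.+1) (X Y : pow C n.+2)
    (f : hom_pow X Y) :
  coface_inner_app j a Y \co fpow_hom f = fpow_hom f \co coface_inner_app j a X.
Proof.
apply: (conj_iso_nat (f := fpow_hom (hom_merge j f))); last exact: nat_nat.
by rewrite /= -!fhom_comp (tens_merge_nat j f).
Qed.

Definition coface_first n (a : nat_end n) : nat_end n.+1 :=
  NatEnd (coface_first_nat a).
Definition coface_last n (a : nat_end n) : nat_end n.+1 :=
  NatEnd (coface_last_nat a).
Definition coface_inner n j (a : nat_end n.+1) : nat_end n.+2 :=
  NatEnd (coface_inner_nat j a).

(* For 1 <= i <= n the i-th coface map merges X_i and X_{i+1}. *)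
Definition coface n : 'I_n.+2 -> nat_end n -> nat_end n.+1 :=
  match n return 'I_n.+2 -> nat_end n -> nat_end n.+1 with
  | 0 => fun i => if val i == 0 then @coface_first 0 else @coface_last 0
  | m.+1 => fun i =>
      if val i == 0 then @coface_first m.+1
      else if val i == m.+2 then @coface_last m.+1
      else @coface_inner m (val i).-1
  end.

(** ** Codegeneracy maps *)

(* When no object is left, the component lives on F(I) instead of I. *)
Definition codegen_app n (j : nat) : nat_end n.+1 ->
    forall X : pow C n, hom (fpow X) (fpow X) :=
  match n return nat_end n.+1 ->
    forall X : pow C n, hom (fpow X) (fpow X) with
  | 0 => fun a _ => conj_iso (iso_inv (fone F)) (a (unit_ob C, tt))
  | m.+1 => fun a X =>
      conj_iso (iso_fun F (@tens_insert k C m j X)) (a (@pow_insert k C m.+1 j X))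
  end.

Lemma codegen_nat n j (a : nat_end n.+1) (X Y : pow C n) (f : hom_pow X Y) :
  codegen_app j a Y \co fpow_hom f = fpow_hom f \co codegen_app j a X.
Proof.
case: n a X Y f => [|n] a X Y f; first by rewrite /= comp_idl comp_idr.
apply: (conj_iso_nat (f := fpow_hom (hom_insert j f))); last exact: nat_nat.
by rewrite /= -!fhom_comp (tens_insert_nat j f).
Qed.

Definition codegen n (i : 'I_n.+1) (a : nat_end n.+1) : nat_end n :=
  NatEnd (codegen_nat i a).

End NatEnd.

(** * Cosimplicial monoids *)

Notation simplex_map p m := {omorphism 'I_p.+1 -> 'I_m.+1}.

(* The injection of [n] into [n+1] missing i. *)
Definition coface_ord n (i : 'I_n.+2) : 'I_n.+1 -> 'I_n.+2 := lift i.

Fact coface_ord_homo n (i : 'I_n.+2) :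
  {homo coface_ord i : x y / (x <= y)%O}.
Proof. by move=> x y; rewrite !leEord /= leq_bump2. Qed.

HB.instance Definition _ n (i : 'I_n.+2) :=
  Order.isOrderMorphism.Build _ _ _ _ (coface_ord i) (@coface_ord_homo n i).

Fact codegen_ord_subproof n (i : 'I_n.+1) (x : 'I_n.+2) : unbump i x < n.+1.
Proof.
rewrite ltnS leq_subLR; case: (ltnP i x) => [_ | xi]; first by rewrite -ltnS.
by rewrite (leq_trans xi) // -ltnS.
Qed.

(* The surjection of [n+1] onto [n] taking the value i twice. *)
Definition codegen_ord n (i : 'I_n.+1) (x : 'I_n.+2) : 'I_n.+1 :=
  Ordinal (codegen_ord_subproof i x).

Fact codegen_ord_homo n (i : 'I_n.+1) :
  {homo codegen_ord i : x y / (x <= y)%O}.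
Proof.
move=> x y; rewrite !leEord /= /unbump => xy; rewrite leq_subLR.
case: (ltnP i x) => ix.
  by rewrite (leq_trans ix xy) subnKC // (leq_trans _ xy) // (leq_trans _ ix).
case: (ltnP i y) => iy; last by rewrite subn0.
by rewrite add0n subn1 (leq_trans ix) // -ltnS prednK // (leq_trans _ iy).
Qed.

HB.instance Definition _ n (i : 'I_n.+1) :=
  Order.isOrderMorphism.Build _ _ _ _ (codegen_ord i) (@codegen_ord_homo n i).

(* A functor from the simplex category to monoids, with values M on objects. *)
Record cosimplicial_monoid (M : nat -> monoidType) := CosimplicialMonoid {
  cs_map : forall p m,
    simplex_map p m -> UMagmaMorphism.type (M p) (M m);
  cs_map_id : forall n (a : M n), cs_map (idfun : simplex_map n n) a = a;
  cs_map_comp : forall p q m (f : simplex_map q m) (g : simplex_map p q)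
    (a : M p),
    cs_map (f \o g : simplex_map p m) a = cs_map f (cs_map g a)
}.

(** * Linking numbers and n-commutativity *)

Section Linking.
Variable m : nat.
Implicit Types (A B S : {set 'I_m.+1}) (As Bs : seq {set 'I_m.+1}).

Definition set_lt A B := forall x y, x \in A -> y \in B -> x < y.
Definition set_le A B := forall x y, x \in A -> y \in B -> x <= y.

(* S is the disjoint union of the nonempty sets As_0 < As_1 < ... *)
Definition ordered_decomposition S As : Prop :=
  [/\ forall A, A \in As -> A != set0,
      forall i j, i < j < size As ->
        [disjoint nth set0 As i & nth set0 As j] /\
        set_lt (nth set0 As i) (nth set0 As j)
    & S = \bigcup_(A <- As) A].

(* As_0 <= Bs_0 <= As_1 <= Bs_1 <= ..., where As has as many terms as Bs or one
   more. Beyond the ends of the sequences the inequalities hold trivially,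
   because the default value of nth is the empty set. *)
Definition alternating As Bs : Prop :=
  size Bs <= size As <= (size Bs).+1 /\
  forall i, set_le (nth set0 As i) (nth set0 Bs i) /\
            set_le (nth set0 Bs i) (nth set0 As i.+1).

Variables p q : nat.
Variables (tau : simplex_map p m) (pi : simplex_map q m).

(* The condition |s - t| <= 1 on the numbers of terms is part of alternating. *)
Definition shuffling (n : nat) As Bs : Prop :=
  [/\ ordered_decomposition [set tau x | x : 'I_p.+1] As,
      ordered_decomposition [set pi x | x : 'I_q.+1] Bs,
      size As + size Bs = n.+1
    & alternating As Bs \/ alternating Bs As].

Definition linking_number (l : nat) : Prop :=
  (exists As Bs, shuffling l As Bs) /\
  forall n As Bs, shuffling n As Bs -> l <= n.

End Linking.

Definition n_commutative (n : nat) (M : nat -> monoidType)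
    (E : cosimplicial_monoid M) : Prop :=
  forall p q m (tau : simplex_map p m) (pi : simplex_map q m) (l : nat),
    linking_number tau pi l -> l <= n ->
    forall (a : M p) (b : M q), commute (cs_map E tau a) (cs_map E pi b).

(* E is the cosimplicial monoid E(F): its coface and codegeneracy maps, which
   determine it, are the given ones. *)
Definition is_cosimplicial_of (k : fieldType) (C D : tensor_category k)
    (F : tensor_functor C D)
    (E : cosimplicial_monoid (fun n => nat_end F n : monoidType)) : Prop :=
  (forall n (i : 'I_n.+2) (a : nat_end F n),
     cs_map E (coface_ord i : simplex_map n n.+1) a = coface i a) /\
  (forall n (i : 'I_n.+1) (a : nat_end F n.+1),
     cs_map E (codegen_ord i : simplex_map n.+1 n) a = codegen i a).

Arguments is_cosimplicial_of {k C D} F E.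

(* Main.v *)
Require Import Defs.
From HB Require Import structures.
From mathcomp Require Import all_boot all_order ssralg.
From mathcomp Require Import boolp.

(** A cosimplicial monoid is a functor on all monotone maps, while only the
coface and codegeneracy maps of E(F) are given by formulas. Rather than check
the cosimplicial identities, each of which hides a coherence argument, the
proof defines the action of every monotone map f : [p] -> [m] at once, in such
a way that functoriality is visible, and identifies it on the generators.

The idea is to replace a tuple of objects by a pseudofunctor from the poset of
natural numbers to the one-object bicategory given by C: objects Y i j for
i <= j, isomorphisms from Y i j \ox Y j l to Y i l and from the unit to Y i i,
associative and unital. A tuple X gives such a Y, namely tup_pfunc X, whose
Y i j is the tensor product of the entries of X from position i to position j.
Such data can be restricted along a monotone map f, by taking Y (f i) (f j),
and this restriction is strictly functorial: all the associativity
isomorphisms are stored in Y.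

An element a of End(F^n) acts on F (Y 0 n) for every Y, because Y 0 n is
canonically the tensor product of the spine Y 0 1, ..., Y (n-1) n. This
endomorphism, ev a Y, is natural in Y (ev_nat). The image of a under f has at
the tuple X the component 1 \ox ev a (pull f Y) \ox 1, where Y = tup_pfunc X and
the middle factor is F (Y (f 0) (f p)) inside F (Y 0 m); the operation
x |-> 1 \ox x \ox 1 is called pad. Since ev of the image of a is again given by
this formula at every Y (ev_act), functoriality reduces to the fact that
padding twice is padding once (pad_pad), which is associativity of the products
Y i j \ox Y j l -> Y i l.

To compare with the given cofaces and codegeneracies, one exhibits in each case
a morphism from tup_pfunc S, where S is the tuple at which the given formula
evaluates a, to the restriction of tup_pfunc X, and uses the naturality of ev
(act_char).

For commutativity, linking number 1 means that one image lies weakly before the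
other, tau <= c <= pi for some c. Then the image of a under tau is x \ox 1 and
the image of b under pi is 1 \ox y with respect to the decomposition of
F (Y 0 m) as F (Y 0 c) \ox F (Y c m), and these commute by interchange
(pad_comm). The extreme cases c = 0 and c = m are included: Y 0 0 and Y m m
are isomorphic to the unit. *)

Set Implicit Arguments.
Unset Strict Implicit.
Unset Printing Implicit Defensive.

Local Open Scope cat_scope.

(** * Cancellation and the coherence of units *)

Section Composition.
Variables (k : fieldType) (C : lin_category k).

Lemma comp_at (W X Y Z : C) (g : hom Y Z) (f : hom X Y) (u : hom X Z)
    (h : hom Z W) : g \co f = u -> h \co g \co f = h \co u.
Proof. by move=> <-; rewrite comp_assoc. Qed.

Lemma comp_cancel (X Y Z : C) (g : hom Y X) (f : hom X Y) (h : hom X Z) :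
  g \co f = idm X -> h \co g \co f = h.
Proof. by move/comp_at->; rewrite comp_idr. Qed.

Lemma retract_epi (X Y Z : C) (u : hom X Y) (v : hom Y X) (f g : hom Y Z) :
  u \co v = idm Y -> f \co u = g \co u -> f = g.
Proof. by move=> uv e; rewrite -[f](comp_cancel _ uv) e (comp_cancel _ uv). Qed.

Lemma iso_epi (X Y Z : C) (u : iso X Y) (f g : hom Y Z) :
  f \co u = g \co u -> f = g.
Proof. exact: retract_epi (bwdK u). Qed.

Lemma iso_mono (X Y Z : C) (u : iso X Y) (f g : hom Z X) :
  u \co f = u \co g -> f = g.
Proof.
move=> e; rewrite -[f]comp_idl -(fwdK u) -comp_assoc e comp_assoc.
by rewrite fwdK comp_idl.
Qed.

(** Both sides are conjugation along u = v \co s, the intertwiner s moving a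
across to b. *)
Lemma conj_eq (X Y Z : C) (u : hom X Z) (u' : hom Z X) (v : hom Y Z)
    (v' : hom Z Y) (s : hom X Y) (a : hom X X) (b : hom Y Y) :
  u \co u' = idm Z -> v' \co v = idm Y -> v \co s = u -> b \co s = s \co a ->
  u \co a \co u' = v \co b \co v'.
Proof.
move=> uK vK su ab; rewrite -su -(comp_assoc v) -ab comp_assoc.
rewrite -[b in LHS]comp_idr -vK !comp_assoc -(comp_assoc _ v s) su.
by rewrite (comp_cancel _ uK).
Qed.

End Composition.

Section UnitCoherence.
Variables (k : fieldType) (C : tensor_category k).
Implicit Types X Y Z W : C.

Lemma comp_tensorh (W X X' X'' Y Y' Y'' : C) (h : hom (X'' \ox Y'') W)
    (f' : hom X' X'') (f : hom X X') (g' : hom Y' Y'') (g : hom Y Y') :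
  h \co (f' \oh g') \co (f \oh g) = h \co ((f' \co f) \oh (g' \co g)).
Proof. by rewrite -comp_assoc tensorh_comp. Qed.

Lemma tensorh_compr X Y Y' Y'' (g : hom Y' Y'') (f : hom Y Y') :
  idm X \oh (g \co f) = (idm X \oh g) \co (idm X \oh f).
Proof. by rewrite -tensorh_comp comp_idl. Qed.

Lemma tensorh_compl X Y Y' Y'' (g : hom Y' Y'') (f : hom Y Y') :
  (g \co f) \oh idm X = (g \oh idm X) \co (f \oh idm X).
Proof. by rewrite -tensorh_comp comp_idl. Qed.

(** The functor I \ox - is faithful, being isomorphic to the identity. The
three lemmas on units below are Kelly's consequences of the triangle and
pentagon axioms, obtained by cancelling a tensor factor I. *)
Lemma tensorh_idl_inj X Y (f g : hom X Y) :
  idm (unit_ob C) \oh f = idm (unit_ob C) \oh g -> f = g.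
Proof. by move=> e; apply: (iso_epi (u := lunit X)); rewrite -!lunit_nat e. Qed.

Lemma tensorh_idr_inj X Y (f g : hom X Y) :
  f \oh idm (unit_ob C) = g \oh idm (unit_ob C) -> f = g.
Proof. by move=> e; apply: (iso_epi (u := runit X)); rewrite -!runit_nat e. Qed.

Lemma lunit_tensor X Y :
  lunit (X \ox Y) \co assoc (unit_ob C) X Y = lunit X \oh idm Y.
Proof.
apply: tensorh_idl_inj.
set I := unit_ob C.
apply: (iso_epi (u := iso_comp (assoc I (I \ox X) Y)
                  (iso_tensor (assoc I I X) (iso_id Y)))) => /=.
rewrite -[idm I in LHS](comp_idl (idm I)) tensorh_comp !comp_assoc.
have := pentagon I I X Y; rewrite -comp_assoc => e.
rewrite -!(comp_assoc (idm I \oh lunit _)).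
rewrite -(comp_assoc (idm I \oh assoc _ _ _)) -e !comp_assoc triangle.
rewrite -tensorh_id -!assoc_nat -comp_assoc -tensorh_comp triangle.
by rewrite comp_idl.
Qed.

Lemma runit_tensor X Y :
  (idm X \oh runit Y) \co assoc X Y (unit_ob C) = runit (X \ox Y).
Proof.
apply: tensorh_idr_inj.
set I := unit_ob C.
apply: (iso_mono (u := assoc X Y I)).
rewrite -{1}[idm I](comp_idl (idm I)) tensorh_comp !comp_assoc assoc_nat.
rewrite -triangle -{1}[idm X](comp_idl (idm X)) tensorh_comp.
rewrite -!(comp_assoc (idm X \oh (idm Y \oh lunit I))).
rewrite -pentagon comp_assoc -assoc_nat -comp_assoc tensorh_id.
by rewrite triangle.
Qed.

Lemma lunit_unit : lunit (unit_ob C) = runit (unit_ob C) :> hom _ _.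
Proof.
apply: tensorh_idr_inj; rewrite -lunit_tensor -triangle; congr (_ \co _).
by apply: (iso_mono (u := lunit (unit_ob C))); rewrite lunit_nat.
Qed.

End UnitCoherence.

(** * Pseudofunctors on the poset of natural numbers *)

(** A pseudofunctor from the poset of natural numbers to C seen as a bicategory
with one object. The structure maps are total functions, so that no proof of i
<= j enters a type; coherence is required for ordered indices only, and the
examples below put zero morphisms at the others. *)
Record pfunc (k : fieldType) (C : tensor_category k) := Path {
  pob :> nat -> nat -> C;
  pmul : forall i j l, hom (pob i j \ox pob j l) (pob i l);
  pmulV : forall i j l, hom (pob i l) (pob i j \ox pob j l);
  pone : forall i, hom (unit_ob C) (pob i i);
  poneV : forall i, hom (pob i i) (unit_ob C)
}.

Arguments pmul {k C} p i j l : rename.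
Arguments pmulV {k C} p i j l : rename.
Arguments pone {k C} p i : rename.
Arguments poneV {k C} p i : rename.

Record coherent (k : fieldType) (C : tensor_category k) (Y : pfunc C) : Prop :=
Coherent {
  pmulK : forall i j l, i <= j <= l -> pmulV Y i j l \co pmul Y i j l = idm _;
  pmulVK : forall i j l, i <= j <= l -> pmul Y i j l \co pmulV Y i j l = idm _;
  poneK : forall i, poneV Y i \co pone Y i = idm _;
  poneVK : forall i, pone Y i \co poneV Y i = idm _;
  pmulA : forall h i j l, h <= i <= j -> j <= l ->
    pmul Y h j l \co (pmul Y h i j \oh idm (Y j l)) =
    pmul Y h i l \co (idm (Y h i) \oh pmul Y i j l) \co assoc _ _ _;
  pmul1p : forall i j, i <= j ->
    pmul Y i i j \co (pone Y i \oh idm (Y i j)) = lunit (Y i j);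
  pmulp1 : forall i j, i <= j ->
    pmul Y i j j \co (idm (Y i j) \oh pone Y j) = runit (Y i j)
}.

(** Iterated restrictions pull f (pull g Y) and pull (g \o f) Y are
convertible: this strictness is the reason for using pseudofunctors instead of
tuples. *)
Definition pull (k : fieldType) (C : tensor_category k) (f : nat -> nat)
    (Y : pfunc C) : pfunc C :=
  @Path k C (fun i j => Y (f i) (f j)) (fun i j l => pmul Y (f i) (f j) (f l))
    (fun i j l => pmulV Y (f i) (f j) (f l)) (fun i => pone Y (f i))
    (fun i => poneV Y (f i)).

Lemma pull_coherent (k : fieldType) (C : tensor_category k) (f : nat -> nat)
    (Y : pfunc C) :
  {homo f : i j / i <= j} -> coherent Y -> coherent (pull f Y).
Proof.
move=> fM cY; split=> /= [i j l /andP[ij jl]|i j l /andP[ij jl]|i|i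
  |h i j l /andP[hi ij] jl|i j ij|i j ij].
- by apply: pmulK; rewrite ?fM.
- by apply: pmulVK; rewrite ?fM.
- exact: poneK.
- exact: poneVK.
- by apply: pmulA; rewrite ?fM.
- by apply: pmul1p; rewrite ?fM.
- by apply: pmulp1; rewrite ?fM.
Qed.

Section Padding.
Variables (k : fieldType) (C : tensor_category k) (Y : pfunc C).
Hypothesis cY : coherent Y.

(** lpad and rpad are the actions of the first and last cofaces, freed from the
choice of a bracketing: 1 \ox x and x \ox 1, read on Y i l. *)
Definition lpad i j l (x : hom (Y j l) (Y j l)) : hom (Y i l) (Y i l) :=
  pmul Y i j l \co (idm (Y i j) \oh x) \co pmulV Y i j l.

Definition rpad i j l (x : hom (Y i j) (Y i j)) : hom (Y i l) (Y i l) :=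
  pmul Y i j l \co (x \oh idm (Y j l)) \co pmulV Y i j l.

Lemma lpadE i j l x : i <= j <= l ->
  lpad i x \co pmul Y i j l = pmul Y i j l \co (idm (Y i j) \oh x).
Proof. by move=> ijl; rewrite /lpad (comp_cancel _ (pmulK cY ijl)). Qed.

Lemma rpadE i j l x : i <= j <= l ->
  rpad l x \co pmul Y i j l = pmul Y i j l \co (x \oh idm (Y j l)).
Proof. by move=> ijl; rewrite /rpad (comp_cancel _ (pmulK cY ijl)). Qed.

Lemma pmul_epi i j l (Z : C) (f g : hom (Y i l) Z) : i <= j <= l ->
  f \co pmul Y i j l = g \co pmul Y i j l -> f = g.
Proof. by move=> ijl; exact: retract_epi (pmulVK cY ijl). Qed.

Lemma lpad1 i j l : i <= j <= l -> lpad i (idm (Y j l)) = idm (Y i l).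
Proof. by move=> ijl; rewrite /lpad tensorh_id comp_idr pmulVK. Qed.

Lemma rpad1 i j l : i <= j <= l -> rpad l (idm (Y i j)) = idm (Y i l).
Proof. by move=> ijl; rewrite /rpad tensorh_id comp_idr pmulVK. Qed.

Lemma lpadM i j l x y : i <= j <= l ->
  @lpad i j l (x \co y) = lpad i x \co lpad i y.
Proof.
move=> ijl; apply: (pmul_epi ijl).
rewrite lpadE // -comp_assoc lpadE // comp_assoc lpadE //.
by rewrite comp_tensorh comp_idl.
Qed.

Lemma rpadM i j l x y : i <= j <= l ->
  @rpad i j l (x \co y) = rpad l x \co rpad l y.
Proof.
move=> ijl; apply: (pmul_epi ijl).
rewrite rpadE // -comp_assoc rpadE // comp_assoc rpadE //.
by rewrite comp_tensorh comp_idl.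
Qed.

(** Precomposing with pone Y i \ox 1, the structure map Y i i \ox Y i j -> Y i
j becomes the left unit isomorphism, which is natural. *)
Lemma lpad_id i j x : i <= j -> @lpad i i j x = x.
Proof.
move=> ij; apply: (pmul_epi (j := i)); rewrite ?leqnn //= lpadE ?leqnn //.
apply: (retract_epi (u := pone Y i \oh idm (Y i j))
  (v := poneV Y i \oh idm (Y i j))).
  by rewrite -tensorh_comp poneVK // comp_idl tensorh_id.
rewrite -(comp_assoc x) pmul1p // -lunit_nat -(pmul1p cY ij).
by rewrite !comp_tensorh !comp_idl !comp_idr.
Qed.

Lemma rpad_id i j x : i <= j -> @rpad i j j x = x.
Proof.
move=> ij; apply: (pmul_epi (j := j)); rewrite ?ij ?leqnn //.
rewrite rpadE ?ij ?leqnn //.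
apply: (retract_epi (u := idm (Y i j) \oh pone Y j)
  (v := idm (Y i j) \oh poneV Y j)).
  by rewrite -tensorh_comp poneVK // comp_idl tensorh_id.
rewrite -(comp_assoc x) pmulp1 // -runit_nat -(pmulp1 cY ij).
by rewrite !comp_tensorh !comp_idl !comp_idr.
Qed.

(** Equations between endomorphisms of Y h l can be tested on the triple
product (Y h i \ox Y i j) \ox Y j l, where associativity moves the paddings
around. *)
Lemma pmul3_epi h i j l (Z : C) (f g : hom (Y h l) Z) :
  h <= i <= j -> j <= l ->
  f \co pmul Y h j l \co (pmul Y h i j \oh idm (Y j l)) =
  g \co pmul Y h j l \co (pmul Y h i j \oh idm (Y j l)) -> f = g.
Proof.
move=> hij jl e; have /andP[hi ij] := hij.
apply: (pmul_epi (j := j)); first by rewrite (leq_trans hi ij).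
apply: (retract_epi (v := pmulV Y h i j \oh idm (Y j l)) _ e).
by rewrite -tensorh_comp pmulVK // comp_idl tensorh_id.
Qed.

Lemma pmulA_at h i j l (Z : C) (f : hom (Y h l) Z) : h <= i <= j -> j <= l ->
  f \co pmul Y h j l \co (pmul Y h i j \oh idm (Y j l)) =
  f \co pmul Y h i l \co (idm (Y h i) \oh pmul Y i j l) \co assoc _ _ _.
Proof.
move=> hij jl; rewrite -!comp_assoc; congr (_ \co _).
by rewrite comp_assoc pmulA // comp_assoc.
Qed.

Lemma lpad_lpad h i j l x : h <= i <= j -> j <= l ->
  lpad h (@lpad i j l x) = lpad h x.
Proof.
move=> hij jl; have /andP[hi ij] := hij.
have hj := leq_trans hi ij; have il := leq_trans ij jl.
apply: (pmul3_epi hij jl); rewrite pmulA_at //.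
rewrite lpadE ?hi // comp_tensorh lpadE ?ij // comp_idl tensorh_compr.
rewrite comp_assoc -[_ \co assoc _ _ _]comp_assoc -assoc_nat.
rewrite comp_assoc -pmulA // tensorh_id comp_tensorh comp_idl comp_idr.
by rewrite lpadE ?hj // comp_tensorh comp_idl comp_idr.
Qed.

Lemma rpad_rpad h i j l x : h <= i <= j -> j <= l ->
  rpad l (@rpad h i j x) = rpad l x.
Proof.
move=> hij jl; have /andP[hi ij] := hij.
have hj := leq_trans hi ij; have il := leq_trans ij jl.
apply: (pmul3_epi hij jl); rewrite [RHS]pmulA_at // rpadE ?hj // comp_tensorh.
rewrite rpadE // rpadE ?hi // comp_idl.
rewrite tensorh_compl comp_assoc pmulA //.
rewrite -comp_assoc assoc_nat tensorh_id comp_assoc.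
by rewrite !comp_tensorh !comp_idl !comp_idr.
Qed.

Lemma lpad_rpad h i j l x : h <= i <= j -> j <= l ->
  lpad h (@rpad i j l x) = rpad l (lpad h x).
Proof.
move=> hij jl; have /andP[hi ij] := hij.
have hj := leq_trans hi ij; have il := leq_trans ij jl.
apply: (pmul3_epi hij jl); rewrite pmulA_at //.
rewrite lpadE ?hi // comp_tensorh rpadE ?ij // comp_idl tensorh_compr.
rewrite comp_assoc -[_ \co assoc _ _ _]comp_assoc -assoc_nat.
rewrite comp_assoc -pmulA // comp_tensorh comp_idl.
by rewrite rpadE ?hj // comp_tensorh lpadE // comp_idl.
Qed.

(** The interchange law of the tensor product. *)
Lemma lpad_rpad_comm i j l (x : hom (Y i j) (Y i j))
    (y : hom (Y j l) (Y j l)) : i <= j <= l ->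
  lpad i y \co rpad l x = rpad l x \co lpad i y.
Proof.
move=> ijl; apply: (pmul_epi ijl).
rewrite -(comp_assoc (lpad i y)) -(comp_assoc (rpad l x)) rpadE // lpadE //.
rewrite !comp_assoc rpadE // lpadE //.
by rewrite !comp_tensorh !comp_idl !comp_idr.
Qed.

(** Recognizes a padded endomorphism in another presentation B of the product
Y i j \ox Y j l: the map s compares the two. *)
Lemma conj_lpad i j l (x : hom (Y j l) (Y j l)) (A B : C) (w : iso (Y i l) A)
    (v : iso B A) (b : hom B B) (s : hom (Y i j \ox Y j l) B) :
  i <= j <= l -> v \co s = w \co pmul Y i j l ->
  b \co s = s \co (idm (Y i j) \oh x) ->
  conj_iso w (lpad i x) = conj_iso v b.
Proof.
move=> ijl vs bs; rewrite /conj_iso /lpad !comp_assoc -[LHS]comp_assoc.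
apply: conj_eq (fwdK v) vs bs.
by rewrite comp_assoc (comp_cancel _ (pmulVK cY ijl)) bwdK.
Qed.

Lemma conj_rpad i j l (x : hom (Y i j) (Y i j)) (A B : C) (w : iso (Y i l) A)
    (v : iso B A) (b : hom B B) (s : hom (Y i j \ox Y j l) B) :
  i <= j <= l -> v \co s = w \co pmul Y i j l ->
  b \co s = s \co (x \oh idm (Y j l)) ->
  conj_iso w (rpad l x) = conj_iso v b.
Proof.
move=> ijl vs bs; rewrite /conj_iso /rpad !comp_assoc -[LHS]comp_assoc.
apply: conj_eq (fwdK v) vs bs.
by rewrite comp_assoc (comp_cancel _ (pmulVK cY ijl)) bwdK.
Qed.

Definition pad h i j l x := lpad h (@rpad i j l x).

Lemma pad_pad g h i j l m x : g <= h <= i -> i <= j <= l -> l <= m ->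
  pad g m (@pad h i j l x) = pad g m x.
Proof.
move=> /andP[gh hi] /andP[ij jl] lm; have hj := leq_trans hi ij.
have jm := leq_trans jl lm; have hl := leq_trans hj jl.
rewrite /pad -lpad_rpad ?hi ?(leq_trans ij) // rpad_rpad ?ij //.
by rewrite lpad_lpad ?gh ?(leq_trans ij).
Qed.

Lemma pad1 h i j l : h <= i <= j -> j <= l ->
  pad h l (idm (Y i j)) = idm (Y h l).
Proof.
by move=> /andP[hi ij] jl; rewrite /pad rpad1 ?ij // lpad1 // hi (leq_trans ij).
Qed.

Lemma padM h i j l x y : h <= i <= j -> j <= l ->
  pad h l (x \co y : hom (Y i j) _) = pad h l x \co pad h l y.
Proof.
move=> /andP[hi ij] jl; rewrite /pad rpadM ?ij // lpadM // hi.
exact: leq_trans ij jl.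
Qed.

Lemma pad_id i j x : i <= j -> @pad i i j j x = x.
Proof. by move=> ij; rewrite /pad rpad_id // lpad_id. Qed.

(** Both factors are padded in two steps through c; the outer steps then act on
the two sides of Y h c \ox Y c l. *)
Lemma pad_comm h i j c i' j' l (x : hom (Y i j) (Y i j))
    (y : hom (Y i' j') (Y i' j')) :
  h <= i <= j -> j <= c -> c <= i' <= j' -> j' <= l ->
  pad h l x \co pad h l y = pad h l y \co pad h l x.
Proof.
move=> hij jc cij jl; have /andP[hi ij] := hij; have /andP[ci ij'] := cij.
have hj := leq_trans hi ij; have hc := leq_trans hj jc.
have cl : c <= l := leq_trans ci (leq_trans ij' jl).
rewrite /pad [lpad h (rpad l x)]lpad_rpad ?(leq_trans jc) //.
rewrite -(rpad_rpad (i := j) (j := c)) ?hj //.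
rewrite -(lpad_lpad (h := h) (i := c) (rpad l y)) ?hc ?(leq_trans ij') //.
by rewrite -lpad_rpad_comm // hc.
Qed.

End Padding.

(** A morphism of pseudofunctors on the objects 0, ..., n. The bound matters
because a tuple of length n is compared with infinite data. *)
Definition pmorph (k : fieldType) (C : tensor_category k) (n : nat)
    (Y Z : pfunc C) (h : forall i j, hom (Y i j) (Z i j)) : Prop :=
  (forall i j l, i <= j <= l -> l <= n ->
     h i l \co pmul Y i j l = pmul Z i j l \co (h i j \oh h j l)) /\
  (forall i, i <= n -> h i i \co pone Y i = pone Z i).

Section Morphisms.
Variables (k : fieldType) (C : tensor_category k).
Variables (n : nat) (Y Z : pfunc C) (h : forall i j, hom (Y i j) (Z i j)).
Hypotheses (cY : coherent Y) (cZ : coherent Z) (hM : pmorph n h).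

Lemma lpad_nat i j l x y : i <= j <= l -> l <= n -> y \co h j l = h j l \co x ->
  lpad i y \co h i l = h i l \co lpad i x.
Proof.
move=> ijl ln e; apply: (pmul_epi cY ijl).
rewrite -(comp_assoc (lpad i y)) -(comp_assoc (h i l)) lpadE // hM.1 //.
rewrite !comp_assoc lpadE // hM.1 //.
by rewrite !comp_tensorh e comp_idl comp_idr.
Qed.

Lemma rpad_nat i j l x y : i <= j <= l -> l <= n -> y \co h i j = h i j \co x ->
  rpad l y \co h i l = h i l \co rpad l x.
Proof.
move=> ijl ln e; apply: (pmul_epi cY ijl).
rewrite -(comp_assoc (rpad l y)) -(comp_assoc (h i l)) rpadE // hM.1 //.
rewrite !comp_assoc rpadE // hM.1 //.
by rewrite !comp_tensorh e comp_idl comp_idr.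
Qed.

Lemma pad_nat g i j l x y : g <= i <= j -> j <= l -> l <= n ->
  y \co h i j = h i j \co x ->
  pad g l y \co h g l = h g l \co pad g l x.
Proof.
move=> /andP[gi ij] jl ln e; have il := leq_trans ij jl.
by apply: lpad_nat; rewrite ?gi //; apply: rpad_nat; rewrite // ij.
Qed.

End Morphisms.

Lemma pull_pmorph (k : fieldType) (C : tensor_category k) (p n : nat)
    (f : nat -> nat) (Y Z : pfunc C) (h : forall i j, hom (Y i j) (Z i j)) :
  {homo f : i j / i <= j} -> (forall i, f i <= n) -> pmorph n h ->
  @pmorph k C p (pull f Y) (pull f Z) (fun i j => h (f i) (f j)).
Proof.
move=> fM fn [hM h1]; split=> /= [i j l /andP[ij jl] _|i _]; last exact: h1.
by apply: hM; rewrite ?fM.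
Qed.

(** * The pseudofunctor of a tuple, and images under a tensor functor *)

Section TuplePath.
Variables (k : fieldType) (C : tensor_category k).
Notation I := (unit_ob C).

(** The tensor product of the entries of X in positions i, ..., j - 1 (counted
from 0), bracketed to the right and ending with a unit object. The trailing
unit treats the empty product, single objects and longer products uniformly,
and makes all the structure maps structural recursions. *)
Fixpoint tup_ob n : pow C n -> nat -> nat -> C :=
  match n with
  | 0 => fun _ _ _ => I
  | n.+1 => fun X i j =>
      match i, j with
      | 0, j.+1 => X.1 \ox @tup_ob n X.2 0 j
      | i.+1, j.+1 => @tup_ob n X.2 i j
      | _, _ => I
      end
  end.

Fixpoint tup_mul n : forall (X : pow C n) i j l,
    hom (tup_ob X i j \ox tup_ob X j l) (tup_ob X i l) :=
  match n return forall (X : pow C n) i j l,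
    hom (tup_ob X i j \ox tup_ob X j l) (tup_ob X i l) with
  | 0 => fun X i j l => lunit I
  | n.+1 => fun X i j l =>
      match i, j, l return
        hom (@tup_ob n.+1 X i j \ox @tup_ob n.+1 X j l) (@tup_ob n.+1 X i l) with
      | 0, 0, l => lunit (@tup_ob n.+1 X 0 l)
      | 0, j.+1, l.+1 =>
          (idm X.1 \oh @tup_mul n X.2 0 j l) \co
            assoc X.1 (tup_ob X.2 0 j) (tup_ob X.2 j l)
      | i.+1, j.+1, l.+1 => @tup_mul n X.2 i j l
      | _, _, _ => 0%R
      end
  end.

Fixpoint tup_mulV n : forall (X : pow C n) i j l,
    hom (tup_ob X i l) (tup_ob X i j \ox tup_ob X j l) :=
  match n return forall (X : pow C n) i j l,
    hom (tup_ob X i l) (tup_ob X i j \ox tup_ob X j l) with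
  | 0 => fun X i j l => bwd (lunit I)
  | n.+1 => fun X i j l =>
      match i, j, l return
        hom (@tup_ob n.+1 X i l) (@tup_ob n.+1 X i j \ox @tup_ob n.+1 X j l) with
      | 0, 0, l => bwd (lunit (@tup_ob n.+1 X 0 l))
      | 0, j.+1, l.+1 =>
          bwd (assoc X.1 (tup_ob X.2 0 j) (tup_ob X.2 j l)) \co
            (idm X.1 \oh @tup_mulV n X.2 0 j l)
      | i.+1, j.+1, l.+1 => @tup_mulV n X.2 i j l
      | _, _, _ => 0%R
      end
  end.

Fixpoint tup_one n : forall (X : pow C n) i, iso I (tup_ob X i i) :=
  match n return forall (X : pow C n) i, iso I (tup_ob X i i) with
  | 0 => fun X i => iso_id I
  | n.+1 => fun X i =>
      match i return iso I (@tup_ob n.+1 X i i) with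
      | 0 => iso_id I
      | i.+1 => @tup_one n X.2 i
      end
  end.

Definition tup_pfunc n (X : pow C n) : pfunc C :=
  @Path k C (tup_ob X) (tup_mul X) (tup_mulV X) (fun i => tup_one X i)
    (fun i => bwd (tup_one X i)).

(** The case h = 0 < i of associativity is the pentagon; the cases with
h = i = 0 and the right unit law are the two tensor compatibilities of the units. *)
Lemma tup_coherent n (X : pow C n) : coherent (tup_pfunc X).
Proof.
split=> [i j l|i j l|i|i|h i j l|i j|i j] /=.
- elim: n X i j l => [|n IH] X [|i] [|j] [|l] //= ijl;
    rewrite ?ltn0 ?andbF // in ijl; try exact: fwdK.
    rewrite comp_assoc comp_tensorh comp_idl.
    by rewrite (IH X.2 0 j l ijl) tensorh_id comp_idr fwdK.
  exact: IH.
- elim: n X i j l => [|n IH] X [|i] [|j] [|l] //= ijl;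
    rewrite ?ltn0 ?andbF // in ijl; try exact: bwdK.
    rewrite comp_assoc (comp_cancel _ (bwdK _)) -tensorh_comp.
    by rewrite (IH X.2 0 j l ijl) comp_idl tensorh_id.
  exact: IH.
- exact: fwdK.
- exact: bwdK.
- elim: n X h i j l => [|n IH] X h i j l /=.
    by move=> _ _; rewrite -comp_assoc triangle lunit_unit.
  case: h i j l => [|h] [|i] [|j] [|l] //= hij jl;
    rewrite ?ltn0 ?andbF // in hij.
  + by rewrite lunit_nat -comp_assoc lunit_tensor.
  + by rewrite lunit_nat -comp_assoc lunit_tensor.
  + by rewrite lunit_nat -[RHS]comp_assoc lunit_tensor.
  + rewrite tensorh_compl comp_assoc -(comp_assoc (_ \oh _) (assoc _ _ _)).
    rewrite assoc_nat !comp_assoc -tensorh_compr (IH X.2 0 i j l) //.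
    rewrite !tensorh_compr -!comp_assoc; congr (_ \co _).
    rewrite (comp_assoc (_ \oh fwd (assoc _ _ _))) -pentagon !comp_assoc.
    by rewrite -assoc_nat tensorh_id.
  + exact: IH.
- elim: n X i j => [|n IH] X [|i] [|j] //= ij;
    rewrite ?tensorh_id ?comp_idr //.
  exact: IH.
- elim: n X i j => [|n IH] X [|i] [|j] //= ij;
    rewrite ?tensorh_id ?comp_idr ?lunit_unit //.
    rewrite -tensorh_id -comp_assoc assoc_nat comp_assoc -tensorh_compr.
    by rewrite (IH X.2 0 j) // runit_tensor.
  exact: IH.
Qed.

Fixpoint tup_hom n : forall (X Y : pow C n) (f : hom_pow X Y) i j,
    hom (tup_ob X i j) (tup_ob Y i j) :=
  match n return forall (X Y : pow C n) (f : hom_pow X Y) i j,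
    hom (tup_ob X i j) (tup_ob Y i j) with
  | 0 => fun X Y f i j => idm I
  | n.+1 => fun X Y f i j =>
      match i, j return hom (@tup_ob n.+1 X i j) (@tup_ob n.+1 Y i j) with
      | 0, j.+1 => f.1 \oh @tup_hom n X.2 Y.2 f.2 0 j
      | i.+1, j.+1 => @tup_hom n X.2 Y.2 f.2 i j
      | _, _ => idm I
      end
  end.

Lemma tup_hom_pmorph N n (X Y : pow C n) (f : hom_pow X Y) :
  @pmorph k C N (tup_pfunc X) (tup_pfunc Y) (tup_hom f).
Proof.
split=> [i j l ijl _|i _] /=.
  elim: n X Y f i j l ijl => [|n IH] X Y f.
    by move=> i j l _ /=; rewrite tensorh_id comp_idl comp_idr.
  case=> [|i] [|j] [|l] //= ijl; rewrite ?ltn0 ?andbF // in ijl;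
      rewrite ?lunit_nat //; last exact: IH.
  rewrite comp_assoc -[RHS]comp_assoc assoc_nat comp_assoc -!tensorh_comp.
  by rewrite (IH X.2 Y.2 f.2 0 j l ijl) comp_idl comp_idr.
by elim: n X Y f i => [|n IH] X Y f [|i] //=; rewrite ?comp_idl.
Qed.

End TuplePath.

Section ImagePath.
Variables (k : fieldType) (C D : tensor_category k) (F : tensor_functor C D).
Variable (Y : pfunc C).

Definition image_pfunc : pfunc D :=
  @Path k D (fun i j => F (Y i j))
    (fun i j l => fhom F (pmul Y i j l) \co fmul F (Y i j) (Y j l))
    (fun i j l => bwd (fmul F (Y i j) (Y j l)) \co fhom F (pmulV Y i j l))
    (fun i => fhom F (pone Y i) \co fone F)
    (fun i => bwd (fone F) \co fhom F (poneV Y i)).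

Lemma fhomK (X Z : C) (u : hom X Z) (v : hom Z X) :
  v \co u = idm X -> fhom F v \co fhom F u = idm (F X).
Proof. by move=> e; rewrite -fhom_comp e fhom_id. Qed.

Lemma image_pfunc_coherent : coherent Y -> coherent image_pfunc.
Proof.
move=> cY; split=> [i j l ijl|i j l ijl|i|i|h i j l hij jl|i j ij|i j ij] /=.
- by rewrite comp_assoc (comp_cancel _ (fhomK (pmulK cY ijl))) fwdK.
- by rewrite comp_assoc (comp_cancel _ (bwdK _)) (fhomK (pmulVK cY ijl)).
- by rewrite comp_assoc (comp_cancel _ (fhomK (poneK cY i))) fwdK.
- by rewrite comp_assoc (comp_cancel _ (bwdK _)) (fhomK (poneVK cY i)).
- rewrite tensorh_compl tensorh_compr !comp_assoc -fhom_id.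
  rewrite -(comp_assoc (fhom F (pmul Y h j l))) fmul_nat.
  rewrite -(fhom_id F (Y h i)) -(comp_assoc (fhom F (pmul Y h i l))) fmul_nat.
  rewrite !comp_assoc -!fhom_comp pmulA //.
  rewrite fhom_comp -!comp_assoc; congr (_ \co _).
  by rewrite !comp_assoc !fhom_id fmul_assoc.
- rewrite tensorh_compl !comp_assoc -(fhom_id F (Y i j)).
  rewrite -(comp_assoc (fhom F (pmul Y i i j))) fmul_nat comp_assoc -fhom_comp.
  by rewrite pmul1p // fhom_id fmul_lunit.
- rewrite tensorh_compr !comp_assoc -(fhom_id F (Y i j)).
  rewrite -(comp_assoc (fhom F (pmul Y i j j))) fmul_nat comp_assoc -fhom_comp.
  by rewrite pmulp1 // fhom_id fmul_runit.
Qed.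

End ImagePath.

Lemma image_pfunc_pmorph (k : fieldType) (C D : tensor_category k)
    (F : tensor_functor C D) (n : nat) (Y Z : pfunc C)
    (h : forall i j, hom (Y i j) (Z i j)) :
  pmorph n h ->
  @pmorph k D n (image_pfunc F Y) (image_pfunc F Z) (fun i j => fhom F (h i j)).
Proof.
move=> [hM h1]; split=> /= [i j l ijl ln|i ln].
  by rewrite comp_assoc -fhom_comp hM // fhom_comp -!comp_assoc fmul_nat.
by rewrite comp_assoc -fhom_comp h1.
Qed.

(** * The spine of a pseudofunctor *)

Section Spine.
Variables (k : fieldType) (C : tensor_category k).
Notation I := (unit_ob C).
Implicit Types Y Z : pfunc C.

Fixpoint spine n Y : pow C n :=
  match n with
  | 0 => tt
  | n.+1 => (Y 0 1, @spine n (pull succn Y))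
  end.

Fixpoint spine_hom n Y Z (h : forall i j, hom (Y i j) (Z i j)) :
    hom_pow (spine n Y) (spine n Z) :=
  match n return hom_pow (spine n Y) (spine n Z) with
  | 0 => tt
  | n.+1 => (h 0 1,
      @spine_hom n (pull succn Y) (pull succn Z) (fun i j => h i.+1 j.+1))
  end.

(** The universal property of tup_pfunc: it is free on the spine, so that the
products of Y induce a morphism from tup_pfunc (spine n Y) to Y. *)
Fixpoint fuse n Y i j : hom (tup_ob (spine n Y) i j) (Y i j) :=
  match n return hom (tup_ob (spine n Y) i j) (Y i j) with
  | 0 =>
      match i, j return hom I (Y i j) with
      | 0, 0 => pone Y 0
      | _, _ => 0%R
      end
  | n.+1 =>
      match i, j return hom (tup_ob (spine n.+1 Y) i j) (Y i j) with
      | 0, 0 => pone Y 0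
      | 0, j.+1 =>
          pmul Y 0 1 j.+1 \co (idm (Y 0 1) \oh @fuse n (pull succn Y) 0 j)
      | i.+1, j.+1 => @fuse n (pull succn Y) i j
      | _, _ => 0%R
      end
  end.

Fixpoint fuseV n Y : hom (Y 0 n) (tup_ob (spine n Y) 0 n) :=
  match n return hom (Y 0 n) (tup_ob (spine n Y) 0 n) with
  | 0 => poneV Y 0
  | n.+1 => (idm (Y 0 1) \oh @fuseV n (pull succn Y)) \co pmulV Y 0 1 n.+1
  end.

Lemma shift_coherent Y : coherent Y -> coherent (pull succn Y).
Proof. by apply: pull_coherent. Qed.

Lemma fuseK n Y : coherent Y -> fuseV n Y \co fuse n Y 0 n = idm _.
Proof.
elim: n Y => [|n IH] Y cY /=; first exact: poneK.
rewrite comp_assoc (comp_cancel _ (pmulK cY (i := 0) (j := 1) (l := n.+1) isT)).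
by rewrite -tensorh_comp (IH _ (shift_coherent cY)) comp_idl tensorh_id.
Qed.

Lemma fuseVK n Y : coherent Y -> fuse n Y 0 n \co fuseV n Y = idm _.
Proof.
elim: n Y => [|n IH] Y cY /=; first exact: poneVK.
rewrite comp_assoc comp_tensorh (IH _ (shift_coherent cY)) comp_idl.
by rewrite tensorh_id comp_idr pmulVK.
Qed.

(** The case i = 0 < j of compatibility with products is associativity of the
products of Y; the case i = j = 0 is its left unit law. *)
Lemma fuse_pmorph n Y : coherent Y ->
  @pmorph k C n (tup_pfunc (spine n Y)) Y (fuse n Y).
Proof.
have unit_case n' Z l : coherent Z ->
    fuse n' Z 0 l \co lunit _ =
    pmul Z 0 0 l \co (pone Z 0 \oh fuse n' Z 0 l).
  move=> cZ; rewrite -[pone Z 0]comp_idr -[fuse n' Z 0 l in RHS]comp_idl.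
  by rewrite tensorh_comp comp_assoc pmul1p // lunit_nat.
move=> cY; split=> [i j l|i] /=.
  elim: n Y cY i j l => [|n IH] Y cY i j l.
    move=> ijl; rewrite leqn0 => /eqP l0; subst l.
    move: ijl; rewrite leqn0 andbC => /andP[/eqP j0]; subst j.
    by rewrite leqn0 => /eqP i0; subst i; apply: (unit_case 0).
  case: i j l => [|i] [|j] [|l] //= ijl ln; rewrite ?ltn0 ?andbF // in ijl.
  - exact: (unit_case n.+1 Y 0).
  - exact: (unit_case n.+1 Y l.+1).
  - rewrite comp_assoc comp_tensorh comp_idl.
    rewrite (IH _ (shift_coherent cY) 0 j l ijl ln) tensorh_compr /=.
    rewrite !comp_assoc -[LHS]comp_assoc -assoc_nat comp_assoc.
    by rewrite -pmulA // comp_tensorh comp_idl.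
  - exact: (IH _ (shift_coherent cY)).
elim: n Y cY i => [|n IH] Y cY [|i] //=; rewrite ?comp_idr // ltnS.
exact: (IH _ (shift_coherent cY)).
Qed.

Lemma fuse_nat n Y Z (h : forall i j, hom (Y i j) (Z i j)) j :
  pmorph n h -> j <= n ->
  h 0 j \co fuse n Y 0 j = fuse n Z 0 j \co tup_hom (spine_hom n h) 0 j.
Proof.
elim: n Y Z h j => [|n IH] Y Z h j [hM h1].
  by case: j => //= _; rewrite comp_idr h1.
case: j => [|j] /= jn; first by rewrite comp_idr h1.
rewrite comp_assoc hM // !comp_tensorh comp_idr comp_idl.
rewrite (IH (pull succn Y) (pull succn Z) (fun i j => h i.+1 j.+1) j) //.
by split=> /= [i j' l ijl ln|i ln]; [apply: hM|apply: h1].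
Qed.

(** The entries of X and the spine of tup_pfunc X differ by trailing units;
these isomorphisms are inverse to fuse by the triangle axiom. *)
Fixpoint spine_tup n : forall X : pow C n, hom_pow X (spine n (tup_pfunc X)) :=
  match n return forall X : pow C n, hom_pow X (spine n (tup_pfunc X)) with
  | 0 => fun X => tt
  | n.+1 => fun X =>
      ((idm X.1 \oh tup_one X.2 0) \co bwd (runit X.1), @spine_tup n X.2)
  end.

Lemma fuse_tup n (X : pow C n) j : j <= n ->
  fuse n (tup_pfunc X) 0 j \co tup_hom (spine_tup X) 0 j = idm _.
Proof.
elim: n X j => [|n IH] X [|j] //= jn; rewrite ?comp_idl //.
rewrite comp_tensorh comp_idl (IH X.2 j jn).
rewrite tensorh_compl !comp_assoc -(comp_assoc _ (fwd (assoc _ _ _))).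
rewrite assoc_nat comp_assoc -tensorh_compr.
rewrite (pmul1p (tup_coherent X.2) (leq0n j)) /= triangle -tensorh_compl.
by rewrite bwdK tensorh_id.
Qed.

End Spine.

(** * The action of monotone maps on natural endomorphisms *)

Section TensIso.
Variables (k : fieldType) (C : tensor_category k).

Fixpoint tup_tens n : forall X : pow C n.+1, iso (tup_ob X 0 n.+1) (tens X) :=
  match n return forall X : pow C n.+1, iso (tup_ob X 0 n.+1) (tens X) with
  | 0 => fun X => runit X.1
  | n.+1 => fun X => iso_tensor (iso_id X.1) (@tup_tens n X.2)
  end.

Lemma tup_tens_nat n (X Y : pow C n.+1) (f : hom_pow X Y) :
  tup_tens Y \co tup_hom f 0 n.+1 = tens_hom f \co tup_tens X.
Proof.
elim: n X Y f => [|n IH] X Y f; first exact: runit_nat.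
rewrite /= -!tensorh_comp; have /= -> := IH X.2 Y.2 f.2.
by rewrite comp_idl comp_idr.
Qed.

End TensIso.

Section Evaluation.
Variables (k : fieldType) (C D : tensor_category k) (F : tensor_functor C D).
Implicit Types Y Z : pfunc C.

Definition tup_fpow n : forall X : pow C n, iso (F (tup_ob X 0 n)) (fpow F X) :=
  match n return forall X : pow C n, iso (F (tup_ob X 0 n)) (fpow F X) with
  | 0 => fun X => iso_inv (fone F)
  | n.+1 => fun X => iso_fun F (tup_tens X)
  end.

Lemma tup_fpow_nat n (X Y : pow C n) (f : hom_pow X Y) :
  tup_fpow Y \co fhom F (tup_hom f 0 n) = fpow_hom F f \co tup_fpow X.
Proof.
case: n X Y f => [|n] X Y f; first by rewrite /= fhom_id comp_idl comp_idr.
by rewrite [LHS]/= -fhom_comp tup_tens_nat fhom_comp.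
Qed.

Definition tup_app n (a : nat_end F n) (X : pow C n) :
    hom (F (tup_ob X 0 n)) (F (tup_ob X 0 n)) :=
  conj_iso (iso_inv (tup_fpow X)) (a X).

Lemma tup_app_nat n (a : nat_end F n) (X Y : pow C n) (f : hom_pow X Y) :
  tup_app a Y \co fhom F (tup_hom f 0 n) =
  fhom F (tup_hom f 0 n) \co tup_app a X.
Proof.
apply: conj_iso_nat (nat_nat a f) => /=.
by apply: iso_bwd_nat; apply: tup_fpow_nat.
Qed.

Definition ev n (a : nat_end F n) Y : hom (F (Y 0 n)) (F (Y 0 n)) :=
  fhom F (fuse n Y 0 n) \co tup_app a (spine n Y) \co fhom F (fuseV n Y).

(** A morphism Y -> Z restricts to the spines, where a is natural, and fuse is
compatible with it. *)
Lemma ev_nat n (a : nat_end F n) Y Z (h : forall i j, hom (Y i j) (Z i j)) :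
  coherent Y -> coherent Z -> pmorph n h ->
  ev a Z \co fhom F (h 0 n) = fhom F (h 0 n) \co ev a Y.
Proof.
move=> cY cZ hM.
have uK := fhomK F (fuseVK n cY); have vK := fhomK F (fuseK n cZ).
apply: (retract_epi uK); rewrite /ev -comp_assoc -fhom_comp.
rewrite fuse_nat // fhom_comp.
rewrite comp_assoc (comp_cancel _ vK) -comp_assoc tup_app_nat.
rewrite !comp_assoc (comp_cancel _ (fhomK F (fuseK n cY))).
by rewrite -!fhom_comp fuse_nat.
Qed.

(** Naturality of a along the maps spine_tup, which split fuse: the trailing
units of tup_pfunc X do not change the component of a. *)
Lemma ev_tup n (a : nat_end F n) (X : pow C n) :
  ev a (tup_pfunc X) = tup_app a X.
Proof.
have cX := tup_coherent X; have e := fuse_tup X (leqnn n).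
apply: (retract_epi (u := fhom F (fuse n (tup_pfunc X) 0 n))
  (v := fhom F (fuseV n (tup_pfunc X)))); first exact: fhomK (fuseVK n cX).
rewrite /ev (comp_cancel _ (fhomK F (fuseK n cX))).
apply: (retract_epi (u := fhom F (tup_hom (spine_tup X) 0 n))
  (v := fhom F (fuse n (tup_pfunc X) 0 n))).
  apply: fhomK; apply: etrans (fuseK n cX).
  by rewrite -[fuseV n _]comp_idr -[in RHS]e comp_assoc fuseK // comp_idl.
rewrite -comp_assoc tup_app_nat comp_assoc -fhom_comp e fhom_id comp_idl.
by rewrite (comp_cancel _ (fhomK F e)).
Qed.

Lemma ev1 n Y : coherent Y -> ev (1%g : nat_end F n) Y = idm _.
Proof.
move=> cY; rewrite /ev /tup_app /conj_iso /= comp_idr fwdK comp_idr.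
exact: fhomK (fuseVK n cY).
Qed.

Lemma evM n (a b : nat_end F n) Y :
  coherent Y -> ev (a * b)%g Y = ev a Y \co ev b Y.
Proof.
move=> cY; have fK := fhomK F (fuseK n cY); rewrite /ev /tup_app /conj_iso /=.
by rewrite !comp_assoc (comp_cancel _ fK) (comp_cancel _ (bwdK _)).
Qed.

End Evaluation.

Section SimplexAction.
Variables (k : fieldType) (C D : tensor_category k) (F : tensor_functor C D).

(** Clamping the argument to [p] keeps the extension monotone on all natural
numbers, and makes it strictly compatible with composition. *)
Definition simplex_nat p m (f : simplex_map p m) (i : nat) : nat :=
  f (inord (minn i p)).

Lemma simplex_nat_homo p m (f : simplex_map p m) :
  {homo simplex_nat f : i j / i <= j}.
Proof.
move=> i j ij; suff: (f (inord (minn i p)) <= f (inord (minn j p)))%O.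
  by rewrite leEord.
apply: Order.OrderMorphismTheory.omorph_le.
rewrite leEord !inordK ?ltnS ?geq_minr //.
by rewrite leq_min geq_minr andbT (leq_trans (geq_minl _ _)).
Qed.

Lemma simplex_nat_le p m (f : simplex_map p m) i : simplex_nat f i <= m.
Proof. by rewrite /simplex_nat -ltnS. Qed.

Lemma simplex_natE p m (f : simplex_map p m) (i : 'I_p.+1) :
  simplex_nat f i = f i.
Proof.
rewrite /simplex_nat; congr (nat_of_ord (f _)); apply: val_inj.
by rewrite (minn_idPl (leq_ord i)) /= inordK.
Qed.

Lemma simplex_nat_comp p q m (f : simplex_map q m) (g : simplex_map p q) :
  simplex_nat (f \o g : simplex_map p m) = simplex_nat f \o simplex_nat g.
Proof.
apply: functional_extensionality_dep => i.
by rewrite /= [simplex_nat g i]/simplex_nat simplex_natE.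
Qed.

Section Action.
Variables (p m : nat) (f : simplex_map p m).
Implicit Types (a b : nat_end F p) (Y Z : pfunc C).

Let f01 : 0 <= simplex_nat f 0 <= simplex_nat f p :=
  simplex_nat_homo f (leq0n p).
Let f1m : simplex_nat f p <= m := simplex_nat_le f p.

(** The formula for the image of a under f at an arbitrary pseudofunctor. In
this generality the formula can be substituted into itself. *)
Definition act_tup (a : nat_end F p) (Y : pfunc C) :=
  pad (Y := image_pfunc F Y) 0 m (ev a (pull (simplex_nat f) Y)).

Lemma act_tup_nat a Y Z (h : forall i j, hom (Y i j) (Z i j)) :
  coherent Y -> coherent Z -> pmorph m h ->
  act_tup a Z \co fhom F (h 0 m) = fhom F (h 0 m) \co act_tup a Y.
Proof.
move=> cY cZ hM.
have fY := pull_coherent (@simplex_nat_homo _ _ f) cY.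
have fZ := pull_coherent (@simplex_nat_homo _ _ f) cZ.
apply: (pad_nat (image_pfunc_coherent F cY) (image_pfunc_coherent F cZ)
  (image_pfunc_pmorph F hM)) => //.
have fh := pull_pmorph p (@simplex_nat_homo _ _ f) (simplex_nat_le f) hM.
exact: (ev_nat a fY fZ fh).
Qed.

Definition act_app (a : nat_end F p) (X : pow C m) :
    hom (fpow F X) (fpow F X) :=
  conj_iso (tup_fpow F X) (act_tup a (tup_pfunc X)).

Lemma act_app_nat a (X Y : pow C m) (u : hom_pow X Y) :
  act_app a Y \co fpow_hom F u = fpow_hom F u \co act_app a X.
Proof.
apply: conj_iso_nat (tup_fpow_nat F u) _.
apply: (act_tup_nat a (tup_coherent X) (tup_coherent Y)).
exact: tup_hom_pmorph.
Qed.

Definition act (a : nat_end F p) : nat_end F m := NatEnd (act_app_nat a).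

(** Both sides are natural along fuse, and agree on tup_pfunc (spine m Y) by
definition. *)
Lemma ev_act a Y : coherent Y -> ev (act a) Y = act_tup a Y.
Proof.
move=> cY; apply: (retract_epi (fhomK F (fuseVK m cY))).
rewrite (act_tup_nat a (tup_coherent (spine m Y)) cY (fuse_pmorph m cY)).
rewrite /ev (comp_cancel _ (fhomK F (fuseK m cY))); congr (_ \co _).
rewrite /tup_app /= /act_app /conj_iso /=; move: (act_tup a _) => x.
by rewrite !comp_assoc fwdK comp_idl (comp_cancel _ (fwdK _)).
Qed.

Lemma act_tup1 Y : coherent Y -> act_tup 1%g Y = idm _.
Proof.
move=> cY; rewrite /act_tup ev1; last first.
  exact: pull_coherent (@simplex_nat_homo _ _ f) cY.
exact: (pad1 (image_pfunc_coherent F cY) f01 f1m).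
Qed.

Lemma act_tupM a b Y : coherent Y ->
  act_tup (a * b)%g Y = act_tup a Y \co act_tup b Y.
Proof.
move=> cY; rewrite /act_tup evM; last first.
  exact: pull_coherent (@simplex_nat_homo _ _ f) cY.
exact: (padM (image_pfunc_coherent F cY) _ _ f01 f1m).
Qed.

Lemma act1 : act 1%g = 1%g.
Proof.
apply: nat_endP => X; rewrite /= /act_app /conj_iso act_tup1.
  by rewrite comp_idr bwdK.
exact: tup_coherent.
Qed.

Lemma actM : {morph act : a b / (a * b)%g}.
Proof.
move=> a b; apply: nat_endP => X; rewrite /= /act_app /conj_iso act_tupM.
  move: (act_tup a _) (act_tup b _) => x y.
  by rewrite !comp_assoc (comp_cancel _ (fwdK _)).
exact: tup_coherent.
Qed.

HB.instance Definition _ :=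
  isUMagmaMorphism.Build (nat_end F p) (nat_end F m) act (act1, actM).

End Action.

(** By ev_act, acting twice inserts the padding for g into the padding for f,
and the two restrictions compose strictly. *)
Lemma act_comp p q m (f : simplex_map q m) (g : simplex_map p q) a :
  act (f \o g : simplex_map p m) a = act f (act g a).
Proof.
apply: nat_endP => X; congr conj_iso.
have cX := tup_coherent X.
rewrite /act_tup ev_act; last exact: pull_coherent (@simplex_nat_homo _ _ f) cX.
rewrite /act_tup simplex_nat_comp.
symmetry; apply: (@pad_pad _ _ _ (image_pfunc_coherent F cX) 0
  (simplex_nat f 0) (simplex_nat f (simplex_nat g 0))
  (simplex_nat f (simplex_nat g p)) (simplex_nat f q)).
- by rewrite leq0n simplex_nat_homo.
- by rewrite !simplex_nat_homo ?simplex_nat_le.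
- exact: simplex_nat_le.
Qed.

End SimplexAction.

(** * Recognizing the action *)

Section Cast.
Variables (k : fieldType) (C : tensor_category k).
Implicit Types Y Z : pfunc C.

(** Transports Y i j along equalities of indices. Zero for different indices,
which avoids carrying the equalities as arguments. *)
Definition cast Y i i' j j' : hom (Y i j) (Y i' j') :=
  match @eqP _ i i', @eqP _ j j' with
  | ReflectT ei, ReflectT ej =>
      ecast i' (hom (Y i j) (Y i' j')) ei
        (ecast j' (hom (Y i j) (Y i j')) ej (idm (Y i j)))
  | _, _ => 0%R
  end.

Lemma cast_id Y i j : cast Y i i j j = idm (Y i j).
Proof.
rewrite /cast; case: eqP => // ei; case: eqP => // ej.
by rewrite !eq_axiomK.
Qed.

Lemma cast_pmorph p Y Z (phi psi : nat -> nat)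
    (h : forall i j, hom (Y i j) (Z (phi i) (phi j))) :
  (forall i, i <= p -> phi i = psi i) ->
  @pmorph k C p Y (pull phi Z) h ->
  @pmorph k C p Y (pull psi Z)
    (fun i j => cast Z (phi i) (psi i) (phi j) (psi j) \co h i j).
Proof.
move=> e [hM h1]; split=> /= [i j l /andP[ij jl] lp|i ip].
  have jp := leq_trans jl lp; have ip := leq_trans ij jp.
  rewrite -!e // !cast_id !comp_idl; apply: hM => //.
  by rewrite ij.
by rewrite -!e // cast_id comp_idl; apply: h1.
Qed.

Lemma cast_cons n (X : pow C n.+1) i j : i = j ->
  cast (tup_pfunc X) 0 0 i.+1 j.+1 =
  idm X.1 \oh cast (tup_pfunc X.2) 0 0 i j.
Proof. by move=> ->; rewrite !cast_id tensorh_id. Qed.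

End Cast.

Section Comparison.
Variables (k : fieldType) (C D : tensor_category k) (F : tensor_functor C D).

(** The action of f can be computed from any morphism h out of tup_pfunc S, for
a tuple S of choice, to the restriction of tup_pfunc X: by naturality ev is
then the component of a at S. The function phi is a recursively computed form
of f, for which h has a convenient type, and i0, i1 are the simplified forms of
its extreme values. *)
Lemma act_char p m (f : simplex_map p m) (a : nat_end F p) (X : pow C m)
    (S : pow C p) (phi : nat -> nat)
    (h : forall i j, hom (tup_ob S i j) (tup_ob X (phi i) (phi j)))
    i0 i1 (v : hom (tup_ob X i0 i1) (tup_ob S 0 p)) :
  (forall i : 'I_p.+1, phi i = f i) -> phi 0 = i0 -> phi p = i1 ->
  @pmorph k C p (tup_pfunc S) (pull phi (tup_pfunc X)) h ->
  let u := cast (tup_pfunc X) (phi 0) i0 (phi p) i1 \co h 0 p in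
  u \co v = idm _ ->
  act f a X = conj_iso (tup_fpow F X)
    (@pad k D (image_pfunc F (tup_pfunc X)) 0 i0 i1 m
       (fhom F u \co tup_app a S \co fhom F v)).
Proof.
move=> fE e0 e1 hM.
have e i : i <= p -> phi i = simplex_nat f i.
  by move=> ip; rewrite (fE (Ordinal (ip : i < p.+1))) -simplex_natE.
have i0E : i0 = simplex_nat f 0 by rewrite -e // e0.
have i1E : i1 = simplex_nat f p by rewrite -e // e1.
clear e0 e1; subst i0 i1; move=> u uv.
have cX := tup_coherent X.
have pX := pull_coherent (@simplex_nat_homo _ _ f) cX.
have := ev_nat a (tup_coherent S) pX (cast_pmorph e hM); rewrite ev_tup => evE.
suff <- : ev a (pull (simplex_nat f) (tup_pfunc X)) =
    fhom F u \co tup_app a S \co fhom F v by [].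
by rewrite -evE -comp_assoc -fhom_comp uv fhom_id comp_idr.
Qed.

End Comparison.

Section FullComparison.
Variables (k : fieldType) (C D : tensor_category k) (F : tensor_functor C D).

(** The case of a map preserving both end points, where there is nothing to
pad: only the effect of h on the products without trailing units matters. *)
Lemma act_char_tens p m (f : simplex_map p.+1 m.+1) (a : nat_end F p.+1)
    (X : pow C m.+1) (S : pow C p.+1) (phi : nat -> nat)
    (h : forall i j, hom (tup_ob S i j) (tup_ob X (phi i) (phi j)))
    (t : iso (tens S) (tens X)) :
  (forall i : 'I_p.+2, phi i = f i) -> phi 0 = 0 -> phi p.+1 = m.+1 ->
  @pmorph k C p.+1 (tup_pfunc S) (pull phi (tup_pfunc X)) h ->
  tup_tens X \co (cast (tup_pfunc X) (phi 0) 0 (phi p.+1) m.+1 \co h 0 p.+1) =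
    t \co tup_tens S ->
  act f a X = conj_iso (iso_fun F t) (a S).
Proof.
move=> fE e0 e1 hM tE.
(* By tE the comparison map is conjugate to t, hence inverted by v. *)
pose v := bwd (tup_tens S) \co bwd t \co tup_tens X.
rewrite (act_char a (v := v) fE e0 e1 hM); last first.
  apply: (iso_mono (u := tup_tens X)).
  rewrite comp_assoc tE /v !comp_assoc (comp_cancel _ (bwdK _)) bwdK.
  by rewrite comp_idl comp_idr.
rewrite pad_id //; last exact: image_pfunc_coherent (tup_coherent X).
rewrite /conj_iso /tup_app /conj_iso /v /= !fhom_comp !comp_assoc.
have fX := fhomK F (bwdK (tup_tens X)); rewrite (comp_cancel _ fX).
have := congr1 (fhom F) tE; rewrite !fhom_comp !comp_assoc => ->.
by rewrite !(comp_cancel _ (fhomK F (bwdK (tup_tens S)))).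
Qed.

End FullComparison.

(** * Morphisms for the inner and last cofaces and the codegeneracies *)

(** cons0 psi is the sequence 0, psi 0, psi 1, ...; the maps for inner cofaces
and codegeneracies have this form, and cons0_iter passes from index j to j + 1.
Their value at 0 is 0 by conversion, as needed to type maps out of
tup_ob S 0 j. *)
Definition cons0 (psi : nat -> nat) (i : nat) : nat :=
  if i is i.+1 then psi i else 0.

Fixpoint cons0_iter (psi : nat -> nat) (j : nat) : nat -> nat :=
  if j is j.+1 then fun i => (cons0 (cons0_iter psi j) i).+1 else psi.

Section ConsMap.
Variables (k : fieldType) (C : tensor_category k).
Notation I := (unit_ob C).

Section Cons.
Variables (p m : nat) (X : C) (S : pow C p) (T : pow C m).
Variables (psi : nat -> nat).
Variable h : forall i j,
  hom (tup_ob S i j) (tup_ob T (cons0 psi i) (cons0 psi j)).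
Let phi := cons0 (fun i => (cons0 psi i).+1).

Definition cons_hom i j :
    hom (@tup_ob k C p.+1 (X, S) i j) (@tup_ob k C m.+1 (X, T) (phi i) (phi j)) :=
  match i, j return
    hom (@tup_ob k C p.+1 (X, S) i j) (@tup_ob k C m.+1 (X, T) (phi i) (phi j)) with
  | 0, 0 => idm I
  | 0, j.+1 => idm X \oh h 0 j
  | i.+1, j.+1 => h i j
  | _, _ => 0%R
  end.

Lemma cons_hom_pmorph n :
  @pmorph k C n (tup_pfunc S) (pull (cons0 psi) (tup_pfunc T)) h ->
  @pmorph k C n.+1 (@tup_pfunc k C p.+1 (X, S))
    (pull phi (@tup_pfunc k C m.+1 (X, T))) cons_hom.
Proof.
move=> [hM h1]; split=> /= [i j l ijl ln|[|i] ln]; last 2 first.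
- by rewrite comp_idl.
- exact: h1.
case: i j l ijl ln => [|i] [|j] [|l] //= ijl ln; rewrite ?ltn0 ?andbF // in ijl.
- by rewrite tensorh_id comp_idl comp_idr.
- by rewrite lunit_nat.
- rewrite comp_assoc -tensorh_compr hM // tensorh_compr -[LHS]comp_assoc.
  by rewrite -assoc_nat comp_assoc.
- exact: hM.
Qed.

End Cons.

(** Merging the first two entries: the associativity isomorphism when both are
involved, the identity on later entries. Its compatibility with products is the
pentagon. *)
Definition merge_head n (X : pow C n.+2) i j :
    hom (@tup_ob k C n.+1 (X.1 \ox X.2.1, X.2.2) i j)
        (tup_ob X (cons0 (fun i => i.+2) i) (cons0 (fun i => i.+2) j)) :=
  match i, j return
    hom (@tup_ob k C n.+1 (X.1 \ox X.2.1, X.2.2) i j)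
        (tup_ob X (cons0 (fun i => i.+2) i) (cons0 (fun i => i.+2) j)) with
  | 0, 0 => idm I
  | 0, j.+1 => assoc X.1 X.2.1 (tup_ob X.2.2 0 j)
  | i.+1, j.+1 => idm (tup_ob X.2.2 i j)
  | _, _ => 0%R
  end.

Lemma merge_head_pmorph N n (X : pow C n.+2) :
  @pmorph k C N (@tup_pfunc k C n.+1 (X.1 \ox X.2.1, X.2.2))
    (pull (cons0 (fun i => i.+2)) (tup_pfunc X)) (merge_head X).
Proof.
split=> /= [i j l ijl _|[|i] _]; last 2 first.
- by rewrite comp_idl.
- by rewrite comp_idl.
case: i j l ijl => [|i] [|j] [|l] //= ijl; rewrite ?ltn0 ?andbF // in ijl.
- by rewrite tensorh_id comp_idl comp_idr.
- by rewrite lunit_nat.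
- rewrite tensorh_compr !comp_assoc -tensorh_id assoc_nat.
  by rewrite -[LHS]comp_assoc pentagon !comp_assoc.
- by rewrite tensorh_id comp_idl comp_idr.
Qed.

Fixpoint merge_hom n j : forall (X : pow C n.+2) a b,
    hom (tup_ob (pow_merge j X) a b)
      (tup_ob X (cons0 (cons0_iter (fun i => i.+2) j) a)
                (cons0 (cons0_iter (fun i => i.+2) j) b)) :=
  match n, j return forall (X : pow C n.+2) a b,
    hom (tup_ob (pow_merge j X) a b)
      (tup_ob X (cons0 (cons0_iter (fun i => i.+2) j) a)
                (cons0 (cons0_iter (fun i => i.+2) j) b)) with
  | 0, 0 => fun X => merge_head X
  | n.+1, 0 => fun X => merge_head X
  | 0, j.+1 => fun X a b => 0%R
  | n.+1, j.+1 => fun X => cons_hom (X.1) (@merge_hom n j X.2)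
  end.

Lemma merge_hom_pmorph n j (X : pow C n.+2) : j <= n ->
  @pmorph k C n.+1 (tup_pfunc (pow_merge j X))
    (pull (cons0 (cons0_iter (fun i => i.+2) j)) (tup_pfunc X)) (merge_hom j X).
Proof.
elim: n j X => [|n IH] [|j] X //= jn; try exact: merge_head_pmorph.
exact: (cons_hom_pmorph X.1 (IH j X.2 jn)).
Qed.

Lemma lift_faceE j i : cons0 (cons0_iter (fun i => i.+2) j) i = bump j.+1 i.
Proof.
elim: j i => [|j IH] [|i] //=.
by rewrite IH /bump ltnS addnS.
Qed.

Lemma merge_hom_tens n j (X : pow C n.+2) : j <= n ->
  let phi := cons0 (cons0_iter (fun i => i.+2) j) in
  tup_tens X \co
    (cast (tup_pfunc X) 0 0 (phi n.+1) n.+2 \co merge_hom j X 0 n.+1) =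
  tens_merge j X \co tup_tens (pow_merge j X).
Proof.
elim: n j X => [|n IH] [|j] X //= jn.
- by rewrite cast_id !comp_idl runit_tensor.
- by rewrite cast_id comp_idl -[in RHS]tensorh_id assoc_nat.
rewrite cast_cons; last first.
  by have /= -> := lift_faceE j n.+1; rewrite /bump jn.
by rewrite -!tensorh_comp (IH j X.2 jn) !comp_idl.
Qed.

(** Inserting a unit in front: the left unit isomorphism when it is involved.
Its compatibility with products is lunit_tensor. *)
Definition insert_head n (X : pow C n) i j :
    hom (@tup_ob k C n.+1 (I, X) i j) (tup_ob X (cons0 id i) (cons0 id j)) :=
  match i, j return
    hom (@tup_ob k C n.+1 (I, X) i j) (tup_ob X (cons0 id i) (cons0 id j)) with
  | 0, 0 => tup_one X 0
  | 0, j.+1 => lunit (tup_ob X 0 j)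
  | i.+1, j.+1 => idm (tup_ob X i j)
  | _, _ => 0%R
  end.

Lemma insert_head_pmorph N n (X : pow C n) :
  @pmorph k C N (@tup_pfunc k C n.+1 (I, X))
    (pull (cons0 id) (tup_pfunc X)) (insert_head X).
Proof.
have cX := tup_coherent X.
have unit_case Z l (u : hom Z (tup_ob X 0 l)) : u \co lunit _ =
    tup_mul X 0 0 l \co (tup_one X 0 \oh u).
  rewrite -[fwd (tup_one X 0)]comp_idr -[u in RHS]comp_idl.
  rewrite tensorh_comp comp_assoc.
  by rewrite (pmul1p cX (leq0n l)) lunit_nat.
split=> /= [i j l ijl _|[|i] _]; last 2 first.
- by rewrite comp_idr.
- by rewrite comp_idl.
case: i j l ijl => [|i] [|j] [|l] //= ijl; rewrite ?ltn0 ?andbF // in ijl.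
- by rewrite comp_assoc lunit_nat -comp_assoc lunit_tensor.
- by rewrite tensorh_id comp_idl comp_idr.
Qed.

Fixpoint insert_hom n j : forall (X : pow C n) a b,
    hom (tup_ob (pow_insert j X) a b)
      (tup_ob X (cons0 (cons0_iter id j) a) (cons0 (cons0_iter id j) b)) :=
  match n, j return forall (X : pow C n) a b,
    hom (tup_ob (pow_insert j X) a b)
      (tup_ob X (cons0 (cons0_iter id j) a) (cons0 (cons0_iter id j) b)) with
  | 0, 0 => fun X => insert_head X
  | n.+1, 0 => fun X => insert_head X
  | 0, j.+1 => fun X a b => 0%R
  | n.+1, j.+1 => fun X => cons_hom (X.1) (@insert_hom n j X.2)
  end.

Lemma insert_hom_pmorph n j (X : pow C n) : j <= n ->
  @pmorph k C n.+1 (tup_pfunc (pow_insert j X))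
    (pull (cons0 (cons0_iter id j)) (tup_pfunc X)) (insert_hom j X).
Proof.
elim: n j X => [|n IH] [|j] X //= jn; try exact: insert_head_pmorph.
exact: (cons_hom_pmorph X.1 (IH j X.2 jn)).
Qed.

Lemma lift_degenE j i : cons0 (cons0_iter id j) i = unbump j i.
Proof.
elim: j i => [|j IH] [|i] //=; first by rewrite /unbump subn1.
by rewrite IH unbumpS.
Qed.

Lemma insert_hom_tens n j (X : pow C n.+1) : j <= n.+1 ->
  let phi := cons0 (cons0_iter id j) in
  tup_tens X \co
    (cast (tup_pfunc X) 0 0 (phi n.+2) n.+1 \co insert_hom j X 0 n.+2) =
  tens_insert j X \co tup_tens (pow_insert j X).
Proof.
elim: n j X => [|n IH] [|j] X //= jn.
- by rewrite cast_id comp_idl -lunit_nat.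
- case: j jn => // _ /=.
  rewrite cast_cons // cast_id tensorh_id !comp_idl.
  by rewrite lunit_unit.
- by rewrite cast_id comp_idl -lunit_nat.
rewrite cast_cons; last first.
  by have /= -> := lift_degenE j n.+2; rewrite /unbump jn subn1.
by rewrite -!tensorh_comp (IH j X.2 jn) !comp_idl.
Qed.

(** Forgetting the last entry. The face map omitting n + 1 is the inclusion on
the indices 0, ..., n, and in the form cons0 it has the type required by
cons_hom. *)
Fixpoint init_hom n : forall (X : pow C n.+1) a b,
    hom (tup_ob (pow_init X) a b)
      (tup_ob X (cons0 (cons0_iter (fun i => i.+2) n) a)
                (cons0 (cons0_iter (fun i => i.+2) n) b)) :=
  match n return forall (X : pow C n.+1) a b,
    hom (tup_ob (pow_init X) a b)
      (tup_ob X (cons0 (cons0_iter (fun i => i.+2) n) a)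
                (cons0 (cons0_iter (fun i => i.+2) n) b)) with
  | 0 => fun X a b =>
      match a, b return
        hom I (tup_ob X (cons0 (fun i => i.+2) a) (cons0 (fun i => i.+2) b)) with
      | 0, 0 => idm I
      | _, _ => 0%R
      end
  | n.+1 => fun X => cons_hom (X.1) (@init_hom n X.2)
  end.

Lemma init_hom_pmorph n (X : pow C n.+1) :
  @pmorph k C n (tup_pfunc (pow_init X))
    (pull (cons0 (cons0_iter (fun i => i.+2) n)) (tup_pfunc X)) (init_hom X).
Proof.
elim: n X => [|n IH] X; last exact: (cons_hom_pmorph X.1 (IH X.2)).
split=> /= [i j l /andP[ij jl]|i]; rewrite leqn0 => /eqP e; subst.
  move: ij; move: jl; rewrite leqn0 => /eqP ->; rewrite leqn0 => /eqP -> /=.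
  by rewrite tensorh_id comp_idl comp_idr.
by rewrite comp_idl.
Qed.

Fixpoint tup_last n :
    forall X : pow C n.+1, hom (tup_ob X n n.+1) (pow_last X) :=
  match n return forall X : pow C n.+1, hom (tup_ob X n n.+1) (pow_last X) with
  | 0 => fun X => runit X.1
  | n.+1 => fun X => @tup_last n X.2
  end.

Definition init_fuse n (X : pow C n.+1) :
    hom (tup_ob (pow_init X) 0 n) (tup_ob X 0 n) :=
  cast (tup_pfunc X) 0 0 (cons0 (cons0_iter (fun i => i.+2) n) n) n \co
    init_hom X 0 n.

Lemma lift_face_last n : cons0 (cons0_iter (fun i => i.+2) n) n = n.
Proof. by rewrite lift_faceE /bump ltnn. Qed.

Lemma init_fuseS n (X : pow C n.+2) :
  init_fuse X = idm X.1 \oh @init_fuse n X.2.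
Proof.
have e := lift_face_last n.
by have /= := cast_cons X e; rewrite /init_fuse tensorh_compr => <-.
Qed.

Lemma init_fuse_iso n (X : pow C n.+1) :
  exists v, init_fuse X \co v = idm _ /\ v \co init_fuse X = idm _.
Proof.
elim: n X => [|n IH] X.
  by exists (idm I); rewrite /init_fuse cast_id !comp_idl.
have [v [uv vu]] := IH X.2; exists (idm X.1 \oh v).
by rewrite init_fuseS -!tensorh_compr uv vu !tensorh_id.
Qed.

(** Relates the product of pow_init X with the last entry, taken in tup_pfunc
X, to the isomorphism tens_last in the definition of the last coface. *)
Lemma init_fuse_tens n (X : pow C n.+2) :
  tup_tens X \co tup_mul X 0 n.+1 n.+2 \co
    (init_fuse X \oh idm (tup_ob X n.+1 n.+2)) =
  tens_last X \co (tup_tens (pow_init X) \oh tup_last X).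
Proof.
elim: n X => [|n IH] X.
  rewrite init_fuseS /init_fuse /= cast_id !comp_idl !tensorh_id comp_idr.
  by rewrite triangle -tensorh_comp comp_idl comp_idr.
rewrite init_fuseS.
rewrite [tup_mul _ _ _ _]/= !comp_assoc -tensorh_comp -comp_assoc assoc_nat.
rewrite comp_assoc -tensorh_comp !comp_idl (IH X.2) /=.
by rewrite -[RHS]comp_assoc assoc_nat comp_assoc -tensorh_compr.
Qed.

End ConsMap.

(** * Cofaces and codegeneracies *)

Section Generators.
Variables (k : fieldType) (C D : tensor_category k) (F : tensor_functor C D).

Lemma tup_appE n (a : nat_end F n) (X : pow C n) :
  tup_fpow F X \co tup_app a X = a X \co tup_fpow F X.
Proof. by rewrite /tup_app /conj_iso /= !comp_assoc bwdK comp_idl. Qed.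

Lemma act_id n (a : nat_end F n) : act (idfun : simplex_map n n) a = a.
Proof.
apply: nat_endP => X; have cX := tup_coherent X.
have hM : @pmorph k C n (tup_pfunc X) (pull id (tup_pfunc X))
    (fun i j => idm (tup_ob X i j)).
  by split=> /= [i j l _ _|i _]; rewrite ?tensorh_id comp_idl ?comp_idr.
rewrite (act_char a (i0 := 0) (i1 := n) (v := idm _) _ _ _ hM) //; last first.
  by rewrite cast_id !comp_idl.
rewrite pad_id //; last exact: image_pfunc_coherent.
rewrite cast_id comp_idl fhom_id comp_idl comp_idr /tup_app /conj_iso /=.
by rewrite !comp_assoc bwdK comp_idl (comp_cancel _ (bwdK _)).
Qed.

(** With S = X.2 the comparison morphism consists of identities, since tup_ob X
at shifted indices is tup_ob X.2; what remains is the left padding by the first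
entry, whose trailing unit is removed by runit. *)
Lemma act_coface_first n (f : simplex_map n n.+1) (a : nat_end F n) :
  (forall i : 'I_n.+1, f i = i.+1 :> nat) -> act f a = coface_first a.
Proof.
move=> fE; apply: nat_endP => X; have cX := tup_coherent X.
have cFX := image_pfunc_coherent F cX.
have hM : @pmorph k C n (tup_pfunc X.2) (pull succn (tup_pfunc X))
    (fun i j => idm (tup_ob X.2 i j)).
  by split=> /= [i j l _ _|i _]; rewrite ?tensorh_id comp_idl ?comp_idr.
rewrite (act_char a (X := X) (S := X.2) (i0 := 1) (i1 := n.+1)
  (v := idm (tup_ob X.2 0 n)) _ _ _ hM) //; last first.
  by rewrite cast_id !comp_idl.
rewrite cast_id comp_idl fhom_id comp_idl comp_idr.
rewrite /pad rpad_id //.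
have aE := tup_appE a X.2.
case: n f a X fE cX cFX hM aE => [|n] f a X fE cX cFX hM aE.
  rewrite [RHS]/=; apply: (conj_lpad cFX (i := 0) (j := 1) (l := 1)
    (s := fhom F (runit X.1) \oh bwd (fone F))) => //.
    rewrite /= -fmul_runit comp_tensorh comp_idl bwdK -(fhom_id F (unit_ob C)).
    rewrite -comp_assoc fmul_nat !comp_assoc -!fhom_comp.
    by rewrite triangle.
  rewrite -!tensorh_comp [X in _ \oh X = _](_ : _ = a X.2 \co bwd (fone F)).
    by rewrite -aE comp_idl comp_idr.
  by case: (X.2).
rewrite [RHS]/=; apply: (conj_lpad cFX (i := 0) (j := 1) (l := n.+2)
  (s := fhom F (runit X.1) \oh fhom F (tup_tens X.2))) => //.
  rewrite fmul_nat /= comp_assoc -fhom_comp; congr (fhom F _ \co _).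
  by rewrite triangle -tensorh_comp comp_idl comp_idr.
by rewrite -!tensorh_comp -aE comp_idl comp_idr.
Qed.

Lemma act_coface_last n (f : simplex_map n n.+1) (a : nat_end F n) :
  (forall i : 'I_n.+1, f i = i :> nat) -> act f a = coface_last a.
Proof.
move=> fE; apply: nat_endP => X; have cX := tup_coherent X.
have cFX := image_pfunc_coherent F cX.
have [v [uv vu]] := init_fuse_iso X.
rewrite (act_char a (i0 := 0) (i1 := n) (v := v) _ _ _ (init_hom_pmorph X)) //;
  last 2 first.
- by move=> i; rewrite fE lift_faceE /bump ltnNge leq_ord.
- exact: lift_face_last.
rewrite -/(init_fuse X) /pad lpad_id //.
have aE : a (pow_init X) \co (tup_fpow F (pow_init X) \co fhom F v) =
    tup_fpow F (pow_init X) \co fhom F v \co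
      (fhom F (init_fuse X) \co tup_app a (pow_init X) \co fhom F v).
  move: (tup_appE a (pow_init X)); move: (tup_app a _) => x xE.
  by rewrite !comp_assoc (comp_cancel _ (fhomK F vu)) xE.
case: n f a X fE cX cFX v uv vu aE => [|n] f a X fE cX cFX v uv vu aE.
  rewrite [RHS]/=; apply: (conj_rpad cFX (i := 0) (j := 0) (l := 1)
    (s := (bwd (fone F) \co fhom F v) \oh fhom F (runit X.1))) => //.
    have -> : v = idm (unit_ob C).
      by move: uv; rewrite /init_fuse cast_id /= !comp_idl.
    rewrite fhom_id comp_idr /= -fmul_lunit comp_tensorh comp_idl bwdK.
    rewrite -(fhom_id F (unit_ob C)) -comp_assoc fmul_nat !comp_assoc.
    by rewrite -!fhom_comp lunit_nat.
  by rewrite -!tensorh_comp comp_idl comp_idr aE.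
rewrite [RHS]/=; apply: (conj_rpad cFX (i := 0) (j := n.+1) (l := n.+2)
  (s := (fhom F (tup_tens (pow_init X)) \co fhom F v) \oh
          fhom F (tup_last X))) => //.
    by rewrite leqnSn.
  rewrite -fhom_comp [LHS]/= -comp_assoc fmul_nat comp_assoc -fhom_comp.
  rewrite [RHS]comp_assoc -[in RHS]fhom_comp; congr (fhom F _ \co _).
  have := congr1 (fun u => u \co (v \oh idm (tup_ob X n.+1 n.+2)))
    (init_fuse_tens X).
  by rewrite !comp_tensorh uv comp_idl tensorh_id !comp_idr => ->.
by rewrite -!tensorh_comp comp_idl comp_idr aE.
Qed.

Lemma act_coface_inner n j (f : simplex_map n.+1 n.+2) (a : nat_end F n.+1) :
  j <= n -> (forall i : 'I_n.+2, f i = bump j.+1 i :> nat) ->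
  act f a = coface_inner j a.
Proof.
move=> jn fE; apply: nat_endP => X.
apply: (act_char_tens a _ _ _ (merge_hom_pmorph X jn)) => //.
- by move=> i; rewrite fE lift_faceE.
- by rewrite lift_faceE /bump ltnS jn.
- exact: merge_hom_tens.
Qed.

Lemma act_coface n (i : 'I_n.+2) (a : nat_end F n) :
  act (coface_ord i : simplex_map n n.+1) a = coface i a.
Proof.
case: n i a => [|n] i a; rewrite /coface.
  case: ifP => [/eqP i0|i0].
    by apply: act_coface_first => x; rewrite /= /bump i0.
  apply: act_coface_last => x; rewrite /= /bump.
  by case: i i0 => [[|[|i]] ?] //= _; case: x => [[|x]].
case: ifP => [/eqP i0|i0].
  by apply: act_coface_first => x; rewrite /= /bump i0.
case: ifP => [/eqP in2|in2].
  by apply: act_coface_last => x; rewrite /= /bump in2 leqNgt ltn_ord.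
have i_gt0 : 0 < i by rewrite lt0n i0.
apply: act_coface_inner => [|x] /=; last by rewrite prednK.
by rewrite -ltnS prednK // -ltnS ltn_neqAle (negbT in2) -ltnS ltn_ord.
Qed.

(** For n = 0 the target has no entries and its component lives on the unit,
which is why fone enters; lunit and runit agree on the unit object. *)
Lemma act_codegen n (i : 'I_n.+1) (a : nat_end F n.+1) :
  act (codegen_ord i : simplex_map n.+1 n) a = codegen i a.
Proof.
apply: nat_endP => X; have iN := leq_ord i.
have hM := insert_hom_pmorph X iN.
case: n i a X iN hM => [|n] i a X iN hM; last first.
  apply: (act_char_tens a _ _ _ hM) => //.
  - by move=> x; rewrite lift_degenE.
  - by rewrite lift_degenE /unbump ltnS iN subn1.
  - exact: insert_hom_tens.
have i0 : i = 0 :> nat by apply/eqP; rewrite -leqn0.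
move: hM; rewrite i0 => hM.
rewrite (act_char a (X := X) (S := pow_insert 0 X) (i0 := 0) (i1 := 0)
  (v := bwd (runit (unit_ob C))) _ _ _ hM) //.
- rewrite pad_id //; last exact: image_pfunc_coherent (tup_coherent X).
  rewrite cast_id comp_idl [fhom F (insert_hom _ _ _ _)]/= lunit_unit.
  congr conj_iso; rewrite /tup_app /conj_iso /= !comp_assoc.
  rewrite !(comp_cancel _ (fhomK F (bwdK _))) fhomK ?bwdK // comp_idl.
  by case: X {hM}.
- by move=> x; rewrite lift_degenE /= i0.
- by rewrite cast_id comp_idl /= lunit_unit bwdK.
Qed.

End Generators.

(** * Commutativity *)

Section Commutation.
Variables (k : fieldType) (C D : tensor_category k) (F : tensor_functor C D).

(** pad_comm applies with c = f p, the largest value of f. *)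
Lemma act_commute p q m (f : simplex_map p m) (g : simplex_map q m)
    (a : nat_end F p) (b : nat_end F q) :
  (forall i j, f i <= g j) -> commute (act f a) (act g b).
Proof.
move=> fg; apply: nat_endP => X.
have cX := image_pfunc_coherent F (tup_coherent X).
have e : act_tup f a (tup_pfunc X) \co act_tup g b (tup_pfunc X) =
    act_tup g b (tup_pfunc X) \co act_tup f a (tup_pfunc X).
  apply: (pad_comm cX (c := simplex_nat f p)).
  - exact: simplex_nat_homo (leq0n p).
  - exact: leqnn.
  - by rewrite fg simplex_nat_homo.
  - exact: simplex_nat_le.
rewrite /= /act_app /conj_iso.
move: (act_tup f a _) (act_tup g b _) e => x y xy.
rewrite !comp_assoc !(comp_cancel _ (fwdK _)) -(comp_assoc _ x y) xy.
by rewrite comp_assoc.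
Qed.

Definition end_cosimplicial :
    cosimplicial_monoid (fun n => nat_end F n : monoidType) :=
  @CosimplicialMonoid (fun n => nat_end F n : monoidType)
    (fun p m f => act f : UMagmaMorphism.type (nat_end F p) (nat_end F m))
    (@act_id k C D F) (@act_comp k C D F).

End Commutation.

(** A shuffling of length at most 1 has at most two terms, and both images are
nonempty, so each of them is a single block. *)
Lemma linking1_separated p q m (tau : simplex_map p m)
    (pi : simplex_map q m) l :
  linking_number tau pi l -> l <= 1 ->
  (forall i j, tau i <= pi j) \/ (forall i j, pi j <= tau i).
Proof.
move=> [[As [Bs [[_ _ AE] [_ _ BE] sz alt]]] _] l1.
have im_neq0 r (f : simplex_map r m) : [set f x | x : 'I_r.+1] != set0.
  by apply/set0Pn; exists (f ord0); apply: imset_f.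
have sz2 : size As + size Bs <= 2 by rewrite sz ltnS.
have As0 : As != [::].
  by apply: contraNneq (im_neq0 _ tau) => As0; rewrite AE As0 big_nil.
have Bs0 : Bs != [::].
  by apply: contraNneq (im_neq0 _ pi) => Bs0; rewrite BE Bs0 big_nil.
case: As Bs As0 Bs0 AE BE sz2 alt {sz} => [|A [|A' As]] [|B [|B' Bs]] //= _ _;
  rewrite ?addSn ?addnS // => AE BE _ alt.
move: AE BE; rewrite !big_seq1 => AE BE.
have tA i : tau i \in A by rewrite -AE imset_f.
have pB j : pi j \in B by rewrite -BE imset_f.
case: alt => [[_ alt]|[_ alt]]; [left|right] => i j.
  by have [/= le _] := alt 0; apply: le.
by have [/= le _] := alt 0; apply: le.
Qed.

Theorem theorem3p4 (k : fieldType) (C D : tensor_category k)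
    (F : tensor_functor C D) :
  exists E : cosimplicial_monoid (fun n => nat_end F n : monoidType),
    is_cosimplicial_of F E /\ n_commutative 1 E.
Proof.
exists (end_cosimplicial F); split.
  by split=> n i a; [apply: act_coface|apply: act_codegen].
move=> p q m tau pi l lk l1 a b.
have [sep|sep] := linking1_separated lk l1; first exact: act_commute.
by apply/esym/act_commute => i j.
Qed.
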